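(* Let $(\mathcal{S},\mathcal{A},P,r)$ be a weakly communicating MDP with finite $\mathcal{S},\mathcal{A}$ ($S,A$ their sizes), unknown $P$ and known $r:\mathcal{S}\times\mathcal{A}\to[0,1]$. Fix $\delta\in(0,1)$ and an integer $n\ge1$ and run the following Empirical Span Penalization algorithm. Draw $n$ i.i.d. samples from each $P(\cdot\mid s,a)$ and form the empirical kernel $\widehat P$. For $i=2,\dots,\lceil\log_2n\rceil$: set $M_i=2^i$, choose $\gamma_i$ with $\frac1{1-\gamma_i}=\max\{\frac{\sqrt{nM_i}}{2\sqrt2\,\alpha(\delta,n)},1\}$, obtain $(\widetilde\pi_i,\widetilde V_i,\tilde r_i)$ from the Span-Constrained Planning algorithm applied to $(\widehat P,r,\gamma_i)$ with span bound $M_i$ and target error $\frac1n$, and set $\Phi(i)=(1-\gamma_i)\min_s\widetilde V_i(s)-\alpha(\delta,n)\sqrt{\frac{M_i+1}{n}}$. Let $\widehat i\in\arg\max_i\Phi(i)$ and output $\widehat\pi=\widetilde\pi_{\widehat i}$ and $\widehat\rho=\max\{\Phi(\widehat i),0\}\mathbf 1$. Then for an absolute constant $C_4$, with probability at least $1-\delta$, elementwise $$\rho^{\widehat\pi}\ \ge\ \widehat\rho\ \ge\ \sup_{\pi:\ \rho^\pi\text{ constant}}\Big\{\rho^\pi-C_4\,\alpha(\delta,n)\sqrt{\frac{\|h^\pi\|_{\mathrm{sp}}+1}{n}}\,\mathbf 1\Big\}.$$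
   Context: Span-Constrained Planning on a DMDP $(Q,r,\gamma)$ with span bound $M$ and target error $\varepsilon$: with $\mathcal{T}_\gamma(V)(s)=\max_a(r(s,a)+\gamma Q_{sa}V)$ and $\mathrm{Clip}_M(V)=\min\{V,(M+\min_{s'}V(s'))\mathbf 1\}$, iterate $V^0=\mathbf 0$, $V^{t+1}=\mathrm{Clip}_M(\mathcal{T}_\gamma(V^t))$ for $T=\lceil\log(\frac3{(1-\gamma)^2\varepsilon})/(1-\gamma)\rceil$ steps; return $\widehat\pi(s)\in\arg\max_a r(s,a)+\gamma Q_{sa}V^T$, the vector $V^T$, and $\tilde r(s,a)=\min\{\min_sV^T(s)+M-\gamma Q_{sa}V^T,r(s,a)\}$. Policies are stationary Markovian; the supremum ranges over policies $\pi$ whose gain vector $\rho^\pi$ has all entries equal. Gain $\rho^\pi(s)=\lim_T\frac1T\mathbb{E}^\pi_s[\sum_{t<T}r(S_t,A_t)]$, bias $h^\pi(s)=\mathrm{C}\text{-}\lim_T\mathbb{E}^\pi_s[\sum_{t<T}(r(S_t,A_t)-\rho^\pi(S_t))]$, $\|x\|_{\mathrm{sp}}=\max x-\min x$. $\alpha(\delta,n)=96\sqrt{\log(24SAn^5/\delta)}\log_2(\log_2(n+4))$. *)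

(* Defs.v *)
From HB Require Import structures.
From mathcomp Require Import all_boot all_order all_algebra.
From mathcomp Require Import all_classical all_reals all_analysis.
Set Implicit Arguments. Unset Strict Implicit. Unset Printing Implicit Defensive.
Import Order.TTheory GRing.Theory Num.Theory numFieldNormedType.Exports.
Local Open Scope ring_scope.

Section Defs.
Variable R : realType.

Definition fmax (T : finType) (F : T -> R) : R :=
  if [pick x : T] is Some x0 then \big[Num.max/F x0]_(x : T) F x else 0.
Definition fmin (T : finType) (F : T -> R) : R :=
  if [pick x : T] is Some x0 then \big[Num.min/F x0]_(x : T) F x else 0.
Definition spnorm (T : finType) (x : T -> R) : R := fmax x - fmin x.

Definition log2 (x : R) : R := ln x / ln 2.

Variables (S A : finType).

Definition is_kernel (P : S -> A -> S -> R) :=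
  forall s a, (forall s', 0 <= P s a s') /\ \sum_(s' : S) P s a s' = 1.

Definition is_policy (pi : S -> A -> R) :=
  forall s, (forall a, 0 <= pi s a) /\ \sum_(a : A) pi s a = 1.

Definition det_policy (d : S -> A) : S -> A -> R := fun s a => (a == d s)%:R.

Definition Ppi (P : S -> A -> S -> R) (pi : S -> A -> R) (s s' : S) : R :=
  \sum_(a : A) pi s a * P s a s'.
Definition rpi (r : S -> A -> R) (pi : S -> A -> R) (s : S) : R :=
  \sum_(a : A) pi s a * r s a.

Fixpoint kstep (K : S -> S -> R) (k : nat) : S -> S -> R :=
  match k with
  | 0 => fun s s' => (s == s')%:R
  | k'.+1 => fun s s' => \sum_(x : S) K s x * kstep K k' x s'
  end.

Definition expect_t (K : S -> S -> R) (t : nat) (f : S -> R) (s : S) : R :=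
  \sum_(s' : S) kstep K t s s' * f s'.

Definition gain P r pi (s : S) : R :=
  limn (fun T : nat => T%:R^-1 * \sum_(t < T) expect_t (Ppi P pi) t (rpi r pi) s).

Definition cesaro_lim (x : nat -> R) : R :=
  limn (fun N : nat => N%:R^-1 * \sum_(1 <= T < N.+1) x T).

Definition bias P r pi (s : S) : R :=
  cesaro_lim (fun T : nat => \sum_(t < T)
     expect_t (Ppi P pi) t (fun s' => rpi r pi s' - gain P r pi s') s).

(* Weakly communicating (Puterman): there is a set C closed under all actions,
   each state of C accessible from every other state of C under some
   deterministic stationary policy, and every state outside C is transient
   under every (stationary) policy. For a finite chain, s is transient iff
   some state reachable from s cannot reach s back. *)
Definition reach (K : S -> S -> R) (s s' : S) := exists k, 0 < kstep K k s s'.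
Definition transient (K : S -> S -> R) (s : S) :=
  exists s', reach K s s' /\ ~ reach K s' s.
Definition weakly_communicating (P : S -> A -> S -> R) :=
  exists C : {set S},
    (forall s a s', s \in C -> 0 < P s a s' -> s' \in C) /\
    (forall s s', s \in C -> s' \in C ->
        exists d : S -> A, reach (Ppi P (det_policy d)) s s') /\
    (forall s, s \notin C -> forall pi, is_policy pi -> transient (Ppi P pi) s).

Definition alpha (delta : R) (n : nat) : R :=
  96 * Num.sqrt (ln (24 * #|S|%:R * #|A|%:R * n%:R ^+ 5 / delta))
     * log2 (log2 (n%:R + 4)).

Definition bellman (Q : S -> A -> S -> R) (r : S -> A -> R) (gamma : R)
  (V : S -> R) (s : S) : R :=
  fmax (fun a : A => r s a + gamma * \sum_(s' : S) Q s a s' * V s').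
Definition clip (M : R) (V : S -> R) (s : S) : R := Num.min (V s) (M + fmin V).
Definition plan_T (gamma eps : R) : nat :=
  `| Num.ceil (ln (3 / ((1 - gamma) ^+ 2 * eps)) / (1 - gamma)) |%N.
Definition plan_V Q r gamma M eps : S -> R :=
  iter (plan_T gamma eps) (fun V => clip M (bellman Q r gamma V)) (fun _ => 0).
Definition plan_policy Q r gamma M eps (pih : S -> A) :=
  forall s a, r s a + gamma * \sum_(s' : S) Q s a s' * plan_V Q r gamma M eps s'
           <= r s (pih s) + gamma * \sum_(s' : S) Q s (pih s) s' * plan_V Q r gamma M eps s'.
Definition plan_rtilde Q r gamma M eps (s : S) (a : A) : R :=
  Num.min (fmin (plan_V Q r gamma M eps) + M
           - gamma * \sum_(s' : S) Q s a s' * plan_V Q r gamma M eps s') (r s a).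

(* samples: X (s, a, k) is the k-th sample from P(. | s, a) *)
Definition emp_kernel (n : nat) (X : {ffun S * A * 'I_n -> S}) : S -> A -> S -> R :=
  fun s a s' => #|[set k : 'I_n | X (s, a, k) == s']|%:R / n%:R.

Definition esp_M (i : nat) : R := 2 ^+ i.
Definition esp_gamma (delta : R) (n i : nat) : R :=
  1 - (Num.max (Num.sqrt (n%:R * esp_M i) / (2 * Num.sqrt 2 * alpha delta n)) 1)^-1.
Definition esp_V (r : S -> A -> R) delta n (X : {ffun S * A * 'I_n -> S}) (i : nat) :=
  plan_V (emp_kernel X) r (esp_gamma delta n i) (esp_M i) (n%:R^-1).
Definition esp_Phi (r : S -> A -> R) delta n (X : {ffun S * A * 'I_n -> S}) (i : nat) : R :=
  (1 - esp_gamma delta n i) * fmin (esp_V r delta X i)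
  - alpha delta n * Num.sqrt ((esp_M i + 1) / n%:R).
Definition esp_index (n i : nat) : bool :=
  (2 <= i)%N && ((Posz i) <= Num.ceil (log2 n%:R)).

(* (pihat, rhohat) is a possible output of the algorithm on the samples X
   (any tie-breaking in both argmax's) *)
Definition esp_output (r : S -> A -> R) delta n (X : {ffun S * A * 'I_n -> S})
    (pihat : S -> A) (rhohat : R) :=
  exists ihat : nat,
    [/\ esp_index n ihat,
        (forall j, esp_index n j -> esp_Phi r delta X j <= esp_Phi r delta X ihat),
        plan_policy (emp_kernel X) r (esp_gamma delta n ihat) (esp_M ihat)
                    (n%:R^-1) pihat
      & rhohat = Num.max (esp_Phi r delta X ihat) 0].

Definition sample_prob (P : S -> A -> S -> R) (n : nat)
    (E : {ffun S * A * 'I_n -> S} -> Prop) : R :=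
  \sum_(X : {ffun S * A * 'I_n -> S})
     (\prod_(j : S * A * 'I_n) P j.1.1 j.1.2 (X j)) * (`[< E X >])%:R.

End Defs.

(* Main.v *)
(* Write theta = sqrt (L M / n) with L the logarithm inside alpha.

   Each value iterate depends on the samples of a pair (s, a) only through the
   scalar value of that pair; freezing this scalar on a grid makes the iterate
   independent of those samples and moves it by O(1/n).  Bernstein's inequality
   with the fixed exponent theta / M then gives, simultaneously on the grid,
   (Phat - P) V <= 2 (theta / M) P (V - V s)^2 + theta.

   Along the greedy policy the centred second moments P (V - V s)^2 telescope up
   to O(M), so V is an approximate solution of a Poisson inequality for the true
   chain and its gain is at least (1 - gamma) min V - O(theta).

   Conversely, if h is the bias of a constant-gain policy, the corrected function
   h + 8 (theta / M) h^2 absorbs the same second moments, and adding a constant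
   turns it into a subsolution of the clipped empirical Bellman equation, whence
   (1 - gamma) min V >= rho - O(theta + (1 - gamma) M). *)
Require Import Defs.
From HB Require Import structures.
From mathcomp Require Import all_boot all_order all_algebra.
From mathcomp Require Import all_classical all_reals all_analysis.
From mathcomp Require Import ring lra.
Import Order.TTheory GRing.Theory Num.Theory numFieldNormedType.Exports.
Local Open Scope ring_scope.

Set Implicit Arguments.
Unset Strict Implicit.
Unset Printing Implicit Defensive.

Definition mean (R : realType) (T : finType) (p f : T -> R) : R :=
  \sum_(x : T) p x * f x.

Definition is_dist (R : realType) (T : finType) (p : T -> R) :=
  (forall x, 0 <= p x) /\ \sum_(x : T) p x = 1.

(** * Means, maxima and minima over a finite type *)

Section Mean.
Variables (R : realType) (T : finType).
Implicit Types (p f g : T -> R) (c : R).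

Lemma eq_mean p f g : f =1 g -> mean p f = mean p g.
Proof. by move=> fg; apply: eq_bigr => x _; rewrite fg. Qed.

Lemma meanD p f g : mean p (fun x => f x + g x) = mean p f + mean p g.
Proof. by rewrite -big_split; apply: eq_bigr => x _; rewrite mulrDr. Qed.

Lemma meanZ p c f : mean p (fun x => c * f x) = c * mean p f.
Proof. by rewrite big_distrr; apply: eq_bigr => x _; rewrite mulrCA. Qed.

Lemma meanN p f : mean p (fun x => - f x) = - mean p f.
Proof. by rewrite -sumrN; apply: eq_bigr => x _; rewrite mulrN. Qed.

Lemma mean_cst p c : is_dist p -> mean p (fun=> c) = c.
Proof. by case=> _ p1; rewrite /mean -big_distrl /= p1 mul1r. Qed.

Lemma ler_mean p f g : is_dist p -> (forall x, f x <= g x) ->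
  mean p f <= mean p g.
Proof. by case=> p0 _ fg; apply: ler_sum => x _; apply: ler_wpM2l. Qed.

Lemma mean_le p f c : is_dist p -> (forall x, f x <= c) -> mean p f <= c.
Proof. by move=> dp fc; rewrite -(mean_cst c dp); apply: ler_mean. Qed.

Lemma mean_ge p f c : is_dist p -> (forall x, c <= f x) -> c <= mean p f.
Proof. by move=> dp fc; rewrite -(mean_cst c dp); apply: ler_mean. Qed.

Lemma ler_mean_shift p f g c : is_dist p -> (forall x, f x <= g x + c) ->
  mean p f <= mean p g + c.
Proof. by move=> dp fg; rewrite -[X in _ + X](mean_cst c dp) -meanD; apply: ler_mean. Qed.

Lemma mean_sqr_center p f c : is_dist p ->
  mean p (fun x => (f x - c) ^+ 2) =
  mean p (fun x => f x ^+ 2) - 2 * c * mean p f + c ^+ 2.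
Proof.
move=> dp.
rewrite (eq_mean p (g := fun x => f x ^+ 2 + (- (2 * c) * f x + c ^+ 2))); last first.
  by move=> x; ring.
by rewrite meanD meanD meanZ mean_cst //; ring.
Qed.

(** The mean minimises the second moment. This allows Bernstein bounds centred at the value of the
    current state, a form that telescopes along the chain. *)
Lemma variance_le p f c : is_dist p ->
  mean p (fun x => (f x - mean p f) ^+ 2) <= mean p (fun x => (f x - c) ^+ 2).
Proof.
move=> dp; rewrite !mean_sqr_center // -subr_ge0.
set m := mean p f; set q := mean p _.
suff -> : q - 2 * c * m + c ^+ 2 - (q - 2 * m * m + m ^+ 2) = (m - c) ^+ 2.
  exact: sqr_ge0.
by ring.
Qed.

End Mean.

Section MaxMin.
Variables (R : realType) (T : finType).
Implicit Types f g : T -> R.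

Lemma le_fmax f x : f x <= fmax f.
Proof.
rewrite /fmax; case: pickP => [x0 _|/(_ x)//].
exact: le_bigmax.
Qed.

Lemma fmin_le f x : fmin f <= f x.
Proof.
rewrite /fmin; case: pickP => [x0 _|/(_ x)//].
exact: bigmin_le.
Qed.

(** The condition [0 <= c] covers the empty type, where [fmax] is 0 by default; [0 <= e] and the
    witness [x0] below have the same origin. *)
Lemma fmax_le f c : 0 <= c -> (forall x, f x <= c) -> fmax f <= c.
Proof.
rewrite /fmax => c0 fc; case: pickP => [x0 _|//].
by apply: bigmax_le => // i _; apply: fc.
Qed.

Lemma le_fmin f c (x0 : T) : (forall x, c <= f x) -> c <= fmin f.
Proof.
rewrite /fmin => fc; case: pickP => [y _|/(_ x0)//].
by apply: le_bigmin => // i _; apply: fc.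
Qed.

Lemma fmin_ge0 f : (forall x, 0 <= f x) -> 0 <= fmin f.
Proof.
rewrite /fmin => fc; case: pickP => [y _|//].
by apply: le_bigmin => // i _; apply: fc.
Qed.

Lemma ler_fmax f g e : 0 <= e -> (forall x, f x <= g x + e) ->
  fmax f <= fmax g + e.
Proof.
rewrite /fmax => e0 fg; case: pickP => [x0 _|_]; last by rewrite add0r.
by apply: bigmax_le => [|i _]; apply: le_trans (fg _) _;
   rewrite lerD2r; apply: le_bigmax.
Qed.

Lemma ler_fmin f g e : 0 <= e -> (forall x, f x <= g x + e) ->
  fmin f <= fmin g + e.
Proof.
rewrite /fmin => e0 fg; case: pickP => [x0 _|_]; last by rewrite add0r.
rewrite -lerBlDr; apply: le_bigmin => [|i _]; rewrite lerBlDr;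
  by apply: le_trans (fg _); apply: bigmin_le.
Qed.

Lemma spnorm_ge0 f : 0 <= spnorm f.
Proof.
rewrite /spnorm subr_ge0 /fmin; case: pickP => [x0 _|T0].
  by apply: le_trans (le_fmax f x0); apply: bigmin_le_id.
by rewrite /fmax; case: pickP => // x; rewrite T0.
Qed.

Lemma ler_clip (M e : R) f g s : 0 <= e -> (forall x, f x <= g x + e) ->
  clip M f s <= clip M g s + e.
Proof.
move=> e0 fg; rewrite /clip addr_minl le_min; apply/andP; split.
  by rewrite ge_min fg.
by rewrite ge_min -addrA lerD2l (ler_fmin e0 fg) orbT.
Qed.

Lemma clip_le (M : R) f s : clip M f s <= f s.
Proof. by rewrite /clip ge_min lexx. Qed.

Lemma clip_span (M : R) f x y : 0 <= M -> clip M f x <= clip M f y + M.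
Proof.
move=> M0; rewrite /clip addr_minl le_min; apply/andP; split.
  by rewrite ge_min [M + _]addrC lerD2r fmin_le orbT.
by rewrite ge_min lerDl M0 orbT.
Qed.

Lemma clip_ge0 (M : R) f s : 0 <= M -> (forall x, 0 <= f x) -> 0 <= clip M f s.
Proof. by move=> M0 f0; rewrite /clip le_min f0 addr_ge0 // fmin_ge0. Qed.

End MaxMin.

(** * Clipped value iteration *)

Section ValueIteration.
Variables (R : realType) (S A : finType) (r : S -> A -> R) (g M : R).
Hypothesis r01 : forall s a, 0 <= r s a <= 1.
Hypothesis g01 : 0 <= g < 1.
Hypothesis M0 : 0 <= M.
Implicit Types (Q : S -> A -> S -> R) (V W U : S -> R).

Definition qvalue Q V s a := r s a + g * mean (Q s a) V.

Definition vstep Q V : S -> R := clip M (bellman Q r g V).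

(* Value iteration in which the value of the pair [z] is frozen at [u]: it does
   not look at the transition probabilities out of [z]. *)
Definition pin_step (z : S * A) (u : R) Q V : S -> R :=
  clip M (fun s => fmax (fun a => if (s, a) == z then u else qvalue Q V s a)).

(** Convertible with [plan_V], with the number of steps left free. *)
Definition viter Q k : S -> R := iter k (vstep Q) (fun=> 0).
Definition pin_iter z u Q k : S -> R := iter k (pin_step z u Q) (fun=> 0).

Let g0 : 0 <= g. Proof. by case/andP: g01. Qed.
Let g1 : 0 < 1 - g. Proof. by case/andP: g01; lra. Qed.
Let gV : g * (1 - g)^-1 + 1 = (1 - g)^-1.
Proof. by field; rewrite lt0r_neq0. Qed.

Lemma qvalue_shift Q V W e s a : is_kernel Q ->
  (forall x, V x <= W x + e) -> qvalue Q V s a <= qvalue Q W s a + g * e.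
Proof.
move=> kQ VW; rewrite /qvalue -addrA lerD2l -mulrDr ler_wpM2l //.
exact: ler_mean_shift (kQ s a) VW.
Qed.

Lemma qvalue_ge0 Q V s a : is_kernel Q -> (forall x, 0 <= V x) ->
  0 <= qvalue Q V s a.
Proof.
move=> kQ V0; case/andP: (r01 s a) => r0 _.
by rewrite addr_ge0 // mulr_ge0 // (mean_ge (kQ s a)).
Qed.

Lemma vstep_shift Q V W e s : is_kernel Q -> 0 <= e ->
  (forall x, V x <= W x + e) -> vstep Q V s <= vstep Q W s + g * e.
Proof.
move=> kQ e0 VW; apply: ler_clip => [|x]; first exact: mulr_ge0.
by apply: ler_fmax => [|a]; [exact: mulr_ge0 | exact: qvalue_shift].
Qed.

(** The pinned entry and the others meet in a maximum, so their errors do not add: [d] only has to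
    dominate both. *)
Lemma pin_step_close Q z u u' V W e d s : is_kernel Q ->
  (forall x, `|V x - W x| <= e) -> `|u - u'| <= d -> g * e <= d ->
  `|pin_step z u Q V s - pin_step z u' Q W s| <= d.
Proof.
move=> kQ VW uu gd.
have d0 : 0 <= d by apply: le_trans uu.
have shift V1 V2 u1 u2 : (forall x, V1 x <= V2 x + e) -> u1 <= u2 + d ->
    pin_step z u1 Q V1 s <= pin_step z u2 Q V2 s + d.
  move=> V12 u12; apply: ler_clip => // x; apply: ler_fmax => // a.
  case: ifP => // _; apply: le_trans (qvalue_shift _ _ kQ V12) _.
  by rewrite lerD2l.
have VW' x : V x <= W x + e /\ W x <= V x + e.
  by have := VW x; rewrite ler_norml => /andP[]; split; lra.
have [u1 u2] : u <= u' + d /\ u' <= u + d.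
  by have := uu; rewrite ler_norml => /andP[]; split; lra.
have := shift V W u u' (fun x => (VW' x).1) u1.
have := shift W V u' u (fun x => (VW' x).2) u2.
by rewrite ler_norml; lra.
Qed.

Lemma vstep_pin Q z V : vstep Q V = pin_step z (qvalue Q V z.1 z.2) Q V.
Proof.
apply/funext => s; congr clip; apply/funext => x; congr fmax; apply/funext => a.
by case: ifP => // /eqP <-.
Qed.

Lemma vstep_close Q V W e s : is_kernel Q ->
  (forall x, `|V x - W x| <= e) -> `|vstep Q V s - vstep Q W s| <= g * e.
Proof.
move=> kQ VW; have e0 : 0 <= e by apply: le_trans (VW s).
have VW' x : V x <= W x + e /\ W x <= V x + e.
  by have := VW x; rewrite ler_norml => /andP[]; split; lra.
have := vstep_shift s kQ e0 (fun x => (VW' x).1).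
have := vstep_shift s kQ e0 (fun x => (VW' x).2).
by rewrite ler_norml; lra.
Qed.

Lemma viter_ge0 Q k s : is_kernel Q -> 0 <= viter Q k s.
Proof.
move=> kQ; elim: k s => [|k IH] s //=.
apply: clip_ge0 => // x; rewrite /bellman /fmax; case: pickP => // a _.
by apply: le_trans (bigmax_ge_id _ _ _ _); apply: qvalue_ge0.
Qed.

Lemma viter_le Q k s : is_kernel Q -> viter Q k s <= (1 - g)^-1.
Proof.
move=> kQ; have i0 : 0 <= (1 - g)^-1 by rewrite invr_ge0 ltW.
elim: k s => [|k IH] s //=.
apply: le_trans (clip_le _ _ _) _; apply: fmax_le => // a.
rewrite -gV addrC; case/andP: (r01 s a) => _ r1.
by rewrite lerD // ler_wpM2l // (mean_le (kQ s a)).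
Qed.

Lemma viter_span Q k x y : viter Q k x <= viter Q k y + M.
Proof. by case: k => [|k] /=; [rewrite add0r | exact: clip_span]. Qed.

Lemma pin_iter_span z u Q k x y : pin_iter z u Q k x <= pin_iter z u Q k y + M.
Proof. by case: k => [|k] /=; [rewrite add0r | exact: clip_span]. Qed.

(** The first step moves 0 by at most the largest reward, and each further step contracts by [g]. *)
Lemma viter_residual Q k s : is_kernel Q ->
  `|vstep Q (viter Q k) s - viter Q k s| <= g ^+ k.
Proof.
move=> kQ; elim: k s => [|k IH] s.
  rewrite subr0 ger0_norm; last exact: (viter_ge0 1).
  apply: le_trans (clip_le _ _ _) _; apply: fmax_le => // a.
  rewrite -[X in _ + g * X]/(mean (Q s a) (fun=> 0)) (mean_cst _ (kQ s a)).
  by rewrite mulr0 addr0; case/andP: (r01 s a).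
by rewrite exprS; apply: vstep_close.
Qed.

Lemma pin_iter_lip z u u' Q k s : is_kernel Q ->
  `|pin_iter z u Q k s - pin_iter z u' Q k s| <= `|u - u'|.
Proof.
move=> kQ; elim: k s => [|k IH] s; first by rewrite subrr normr0.
apply: (pin_step_close z s kQ IH (lexx _)).
by rewrite ler_piMl //; case/andP: g01 => _ /ltW.
Qed.

(** Pinned at its own q-value, a step acts on [viter Q k] like an unpinned one, so [viter Q k] is a
    fixed point up to [g ^+ k]. Contraction sums this defect geometrically and forgets the start at
    0. *)
Lemma pin_iter_close z Q k j s : is_kernel Q ->
  `|pin_iter z (qvalue Q (viter Q k) z.1 z.2) Q j s - viter Q k s|
    <= (g ^+ j + g ^+ k) * (1 - g)^-1.
Proof.
move=> kQ; set u := qvalue _ _ _ _.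
have i0 : 0 <= (1 - g)^-1 by rewrite invr_ge0 ltW.
elim: j s => [|j IH] s.
  rewrite /= sub0r normrN ger0_norm; last exact: viter_ge0.
  apply: le_trans (viter_le _ _ kQ) _.
  by rewrite ler_peMl // expr0 lerDl exprn_ge0.
have := pin_step_close z s kQ IH (_ : `|u - u| <= _) (lexx _).
rewrite subrr normr0 -vstep_pin => /(_ (mulr_ge0 g0 _)) H.
have {}H := H (mulr_ge0 (addr_ge0 (exprn_ge0 _ g0) (exprn_ge0 _ g0)) i0).
have := ler_distD (vstep Q (viter Q k) s) (pin_iter z u Q j.+1 s) (viter Q k s).
move/le_trans; apply; apply: le_trans (lerD H (viter_residual k s kQ)) _.
suff -> : g * ((g ^+ j + g ^+ k) * (1 - g)^-1) + g ^+ k =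
    g ^+ j.+1 * (1 - g)^-1 + g ^+ k * (g * (1 - g)^-1 + 1).
  by rewrite gV -mulrDl.
by rewrite exprS; ring.
Qed.

(** Comparison principle: monotonicity preserves the order between a subsolution and the iterates,
    and the initial gap [B] is discounted at each step. *)
Lemma viter_lower Q U B k s : is_kernel Q ->
  (forall x, U x <= vstep Q U x) -> 0 <= B -> (forall x, U x <= B) ->
  U s <= viter Q k s + g ^+ k * B.
Proof.
move=> kQ UF B0 UB; elim: k s => [|k IH] s; first by rewrite add0r mul1r.
apply: le_trans (UF s) _; rewrite exprS -mulrA.
by apply: vstep_shift => //; rewrite mulr_ge0 // exprn_ge0.
Qed.

(** The purpose of pinning: for the empirical kernel, the iterate becomes a function of the samples
    of the other pairs only. *)
Lemma eq_pin_iter z u Q Q' k : (forall s a, (s, a) != z -> Q s a = Q' s a) ->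
  pin_iter z u Q k = pin_iter z u Q' k.
Proof.
move=> QQ; elim: k => //= k ->; congr clip; apply/funext => s.
congr fmax; apply/funext => a; case: ifPn => // /QQ.
by rewrite /qvalue => ->.
Qed.

End ValueIteration.

(** * Cesaro averages of a finite Markov chain *)

Section Cesaro.
Variable R : realType.

(** Turns bounds on total rewards, with an error uniform in the horizon, into inequalities between
    gains. *)
Lemma archi_le0 (a b : R) : (forall T : nat, T%:R * a <= b) -> a <= 0.
Proof.
move=> Tab; rewrite leNgt; apply/negP => a0.
have b0 : 0 <= b by have := Tab 0%N; rewrite mul0r.
have := Tab (Num.bound (b / a)); rewrite leNgt => /negP; apply.
by rewrite -ltr_pdivrMr //; apply: le_lt_trans (archi_boundP _);
   rewrite ?divr_ge0 // ltW.
Qed.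

Lemma cvg_average (a b : nat -> R) (x c : R) :
  (forall T, a T = T%:R * x + b T) -> (forall T, `|b T| <= c) ->
  limn (fun T => T%:R^-1 * a T) = x.
Proof.
move=> aE bc; apply/cvg_lim => //; apply/cvgrPdist_lt => e e0.
have c0 : 0 <= c by apply: le_trans (bc 0%N).
near=> T.
have T0 : 0 < T%:R :> R by near: T; exact: nbhs_infty_gtr.
rewrite aE mulrDr mulKf ?lt0r_neq0 // opprD addNKr normrN normrM.
rewrite gtr0_norm ?invr_gt0 // mulrC ltr_pdivrMr //.
apply: le_lt_trans (bc T) _; rewrite mulrC -ltr_pdivrMr //.
by near: T; exact: nbhs_infty_gtr.
Unshelve. all: by end_near.
Qed.

Variables (S : finType) (K : S -> S -> R).
Hypothesis kK : forall s, is_dist (K s).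
Implicit Types f x y : S -> R.

Definition kop f s := mean (K s) f.
Definition kpow t f := iter t kop f.

Lemma kpowD t f y : kpow t (fun s => f s + y s) = fun s => kpow t f s + kpow t y s.
Proof. by elim: t => //= t ->; apply/funext => s; rewrite /kop meanD. Qed.

Lemma kpowN t f : kpow t (fun s => - f s) = fun s => - kpow t f s.
Proof. by elim: t => //= t ->; apply/funext => s; rewrite /kop meanN. Qed.

Lemma kpow_kop t f : kpow t (kop f) = kpow t.+1 f.
Proof. by rewrite /kpow iterSr. Qed.

Lemma ler_kpow t f y s : (forall z, f z <= y z) -> kpow t f s <= kpow t y s.
Proof. by move=> fy; elim: t s => //= t IH s; apply: ler_mean. Qed.

Lemma kpow_bound f : exists c : R, forall t s, `|kpow t f s| <= c.
Proof.
exists (fmax (fun s => `|f s|)) => t s.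
elim: t s => [|t IH] s; first exact: (le_fmax (fun s => `|f s|)).
have {}IH z : - fmax (fun s => `|f s|) <= kpow t f z <= fmax (fun s => `|f s|).
  by rewrite -ler_norml.
by rewrite ler_norml mean_ge ?mean_le // => z; case/andP: (IH z).
Qed.

Lemma expect_tE t f s : expect_t K t f s = kpow t f s.
Proof.
elim: t s => [|t IH] s.
  rewrite /expect_t /= (bigD1 s) //= eqxx mul1r big1 ?addr0 // => x xs.
  by rewrite eq_sym (negbTE xs) mul0r.
rewrite /expect_t /=.
under eq_bigr do rewrite big_distrl /=.
rewrite exchange_big /=; apply: eq_bigr => x _.
by rewrite -IH /expect_t big_distrr /=; apply: eq_bigr => z _; rewrite mulrA.
Qed.

Lemma kpow_telescope y T s :
  \sum_(t < T) kpow t (fun z => y z - kop y z) s = y s - kpow T y s.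
Proof.
elim: T => [|T IH]; first by rewrite big_ord0 subrr.
by rewrite big_ord_recr /= IH kpowD kpowN kpow_kop /= addrA subrK.
Qed.

Lemma kpow_fixed x t : kop x =1 x -> kpow t x = x.
Proof. by move=> /funext Kx; elim: t => //= t ->. Qed.

(* [ker (1 - K)] and [im (1 - K)] meet trivially because the powers of [K] are
   bounded, so by rank-nullity they span all functions. *)
Lemma fixed_coboundary_eq0 x y :
  kop x =1 x -> (forall s, x s = y s - kop y s) -> forall s, x s = 0.
Proof.
move=> Kx xE s; have [c yc] := kpow_bound y.
have Tx T : T%:R * x s = y s - kpow T y s.
  rewrite -kpow_telescope -(funext xE).
  by under eq_bigr do rewrite kpow_fixed //; rewrite sumr_const card_ord mulr_natl.
have y0 := yc 0%N s; apply/eqP; rewrite eq_le -oppr_le0; apply/andP; split;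
  apply: (@archi_le0 _ (2 * c)) => T; rewrite ?mulrN Tx;
  move: y0 (yc T s); rewrite !ler_norml /= => /andP[? ?] /andP[? ?]; lra.
Qed.

(** For a reward [f], [x] is the gain and [y] solves the Poisson equation. The argument is pure
    linear algebra and so covers chains with several recurrent classes and periodic ones. *)
Lemma fixed_coboundary_decomp f :
  exists x y, kop x =1 x /\ forall s, f s = x s + (y s - kop y s).
Proof.
pose row_of (h : S -> R) := \row_(i < #|S|) h (enum_val i).
pose fun_of (v : 'rV[R]_#|S|) s := v 0 (enum_rank s).
(* [B] is the transpose of [K], since [kermx] and row spaces act on row vectors from the left. *)
pose B : 'M[R]_#|S| := \matrix_(i, j) K (enum_val j) (enum_val i).
have fun_ofB v s : fun_of (v *m (1%:M - B)) s = fun_of v s - kop (fun_of v) s.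
  rewrite mulmxBr mulmx1 /fun_of !mxE; congr (_ - _).
  rewrite /kop /mean (reindex (fun i : 'I_#|S| => enum_val i)) /=; last first.
    exact: (onW_bij _ (enum_val_bij _)).
  by apply: eq_bigr => i _; rewrite !mxE enum_rankK mulrC enum_valK.
set N := 1%:M - B.
have NB0 : (kermx N :&: N)%MS = 0.
  apply/eqP; rewrite -submx0; apply/rV_subP => v; rewrite sub_capmx.
  case/andP => /sub_kermxP vN /submxP[y vy].
  rewrite submx0; apply/eqP/rowP => i; rewrite !mxE.
  have := @fixed_coboundary_eq0 (fun_of v) (fun_of y) _ _ (enum_val i).
  rewrite /fun_of enum_valK; apply=> s.
    have := fun_ofB v s; rewrite vN /fun_of mxE => /esym/eqP.
    by rewrite subr_eq0 => /eqP ->.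
  by rewrite -[LHS]/(fun_of v s) vy fun_ofB.
have full : row_full (kermx N + N)%MS.
  apply/eqP; have := mxrank_sum_cap (kermx N) N.
  by rewrite NB0 mxrank0 addn0 mxrank_ker subnK // rank_leq_row.
have /sub_addsmxP[[u w] fE] : (row_of f <= kermx N + N)%MS by exact: submx_full.
exists (fun_of (u *m kermx N)), (fun_of w); split=> s.
  have := fun_ofB (u *m kermx N) s.
  rewrite -mulmxA mulmx_ker mulmx0 {1}/fun_of mxE => /esym/eqP.
  by rewrite subr_eq0 => /eqP ->.
rewrite -fun_ofB -[LHS]/(f s); transitivity (fun_of (row_of f) s).
  by rewrite /fun_of mxE enum_rankK.
by rewrite fE /fun_of mxE.
Qed.

Section Decomposition.
Variables f x y : S -> R.
Hypotheses (Kx : kop x =1 x) (fE : forall s, f s = x s + (y s - kop y s)).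

Lemma sum_kpow_decomp T s :
  \sum_(t < T) kpow t f s = T%:R * x s + (y s - kpow T y s).
Proof.
rewrite (funext fE); under eq_bigr do rewrite kpowD kpow_fixed //.
by rewrite big_split /= kpow_telescope sumr_const card_ord mulr_natl.
Qed.

Lemma cesaro_kpow s :
  limn (fun T : nat => T%:R^-1 * \sum_(t < T) kpow t f s) = x s.
Proof.
have [c yc] := kpow_bound y.
apply: (@cvg_average _ (fun T => y s - kpow T y s) _ (c + c)) => T.
  exact: sum_kpow_decomp.
by apply: le_trans (ler_normB _ _) _; exact: lerD (yc 0%N s) (yc T s).
Qed.

End Decomposition.

End Cesaro.

(** * Gain and bias of a stationary policy, and the Poisson equation *)

Lemma is_dist_Ppi (R : realType) (S A : finType) (P : S -> A -> S -> R)
    (pi : S -> A -> R) :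
  is_kernel P -> is_policy pi -> forall s, is_dist (Ppi P pi s).
Proof.
move=> kP ppi s; have [pi0 pi1] := ppi s; split=> [x|].
  by apply: sumr_ge0 => a _; rewrite mulr_ge0 // (kP s a).1.
rewrite exchange_big /= -[RHS]pi1; apply: eq_bigr => a _.
by rewrite -big_distrr /= (kP s a).2 mulr1.
Qed.

Section GainBias.
Variables (R : realType) (S A : finType) (P : S -> A -> S -> R).
Variables (r pi : S -> A -> R).
Hypotheses (kP : is_kernel P) (ppi : is_policy pi).

Let K := Ppi P pi.
Let f := rpi r pi.
Let kK : forall s, is_dist (K s) := is_dist_Ppi kP ppi.

Lemma gain_decomp x y : kop K x =1 x ->
  (forall s, f s = x s + (y s - kop K y s)) -> gain P r pi =1 x.
Proof.
move=> Kx fE s; rewrite /gain -(cesaro_kpow kK Kx fE s).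
by congr (limn _); apply/funext => T; congr (_ * _);
   apply: eq_bigr => t _; rewrite expect_tE.
Qed.

(** Along the chain the differences [W - K W] telescope to a bounded quantity, so the total reward
    over [T] steps is at least [T c - O(1)]. *)
Lemma gain_ge c W : (forall s, c + (W s - kop K W s) <= f s) ->
  forall s, c <= gain P r pi s.
Proof.
move=> cf s; have [x [y [Kx fE]]] := fixed_coboundary_decomp kK f.
rewrite (gain_decomp Kx fE) -subr_le0.
have [cy yc] := kpow_bound kK y; have [cW Wc] := kpow_bound kK W.
apply: (@archi_le0 _ _ (2 * cy + 2 * cW)) => T.
have : \sum_(t < T) kpow K t (fun z => c + (W z - kop K W z)) s <=
       \sum_(t < T) kpow K t f s.
  by apply: ler_sum => t _; apply: ler_kpow.
(* The lower bound is itself in decomposed form, with the constant [c] as its fixed part. *)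
rewrite (sum_kpow_decomp Kx fE) (sum_kpow_decomp (x := fun=> c) (y := W)) //;
  last by move=> z; exact: mean_cst.
move: (yc 0%N s) (yc T s) (Wc 0%N s) (Wc T s); rewrite !ler_norml /=.
move=> /andP[? ?] /andP[? ?] /andP[? ?] /andP[? ?]; lra.
Qed.

Lemma gain_ge0 : (forall s a, 0 <= r s a) -> forall s, 0 <= gain P r pi s.
Proof.
move=> r0; apply: (gain_ge (W := fun=> 0)) => s.
rewrite /kop mean_cst; last exact: kK.
by rewrite subrr addr0; apply: (mean_ge (ppi s)).
Qed.

Lemma gain_le c : (forall s, f s <= c) -> forall s, gain P r pi s <= c.
Proof.
move=> fc s; have [x [y [Kx fE]]] := fixed_coboundary_decomp kK f.
rewrite (gain_decomp Kx fE) -subr_le0.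
have [cy yc] := kpow_bound kK y.
apply: (@archi_le0 _ _ (2 * cy)) => T.
have : \sum_(t < T) kpow K t f s <= \sum_(t < T) kpow K t (fun=> c) s.
  by apply: ler_sum => t _; apply: ler_kpow.
rewrite (sum_kpow_decomp Kx fE).
have Kc : kop K (fun=> c) =1 (fun=> c) by move=> z; exact: mean_cst.
under [X in _ <= X]eq_bigr do rewrite (kpow_fixed _ Kc).
rewrite sumr_const card_ord -mulr_natl.
move: (yc 0%N s) (yc T s); rewrite !ler_norml /= => /andP[? ?] /andP[? ?]; lra.
Qed.

(** The partial sums in the bias are [y - K^T y]. Decomposing [y = x' + (z - K z)] once more shows
    that [K^T y] averages to [x'], so the bias is [y - x']; subtracting the invariant [x'] preserves
    the Poisson equation. *)
Lemma poisson_equation s :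
  gain P r pi s + bias P r pi s = f s + kop K (bias P r pi) s.
Proof.
have [x [y [Kx fE]]] := fixed_coboundary_decomp kK f.
have gE := gain_decomp Kx fE.
have [x' [z [Kx' yE]]] := fixed_coboundary_decomp kK y.
have bE : bias P r pi =1 (fun s => y s - x' s).
  move=> {}s; rewrite /bias /cesaro_lim.
  have [c zc] := kpow_bound kK z.
  (* Averaging starts at horizon 1, so the remainder telescopes from [K z] and not from [z]. *)
  apply: (@cvg_average _ _ (fun N => kpow K N.+1 z s - kop K z s) _ (c + c)).
    move=> N; rewrite big_add1 /= big_mkord.
    under eq_bigr => T _.
      under eq_bigr => t _ do rewrite expect_tE.
      rewrite (_ : (fun s' => _) = (fun s' => y s' - kop K y s')); last first.
        by apply/funext => w; rewrite gE -[rpi r pi w]/(f w) fE addrC addKr.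
      rewrite kpow_telescope // {2}(funext yE) kpowD (kpow_fixed _ Kx').
      rewrite kpowD kpowN kpow_kop.
      over.
    elim: N => [|N IH]; first by rewrite big_ord0 mul0r add0r subrr.
    by rewrite big_ord_recr /= IH -natr1 /=; ring.
  move=> N; apply: le_trans (ler_normB _ _) _.
  exact: lerD (zc N.+1 s) (zc 1%N s).
rewrite gE fE (funext bE) /kop meanD meanN -!/(kop K _ s) Kx'.
by ring.
Qed.

End GainBias.

(** * Concentration of the empirical kernel *)

Section Resampling.
Variables (R : realType) (J T : finType) (w : J -> T -> R).
Hypothesis dw : forall j, is_dist (w j).

Lemma prod_dist_total : \sum_(X : {ffun J -> T}) \prod_j w j (X j) = 1.
Proof.
by rewrite -bigA_distr_bigA big1 // => j _; exact: (dw j).2.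
Qed.

(* Conditionally on the coordinates outside [D], the factors [phi X (X j)],
   [j \in D], are independent with mean at most 1. *)
Lemma prod_resample (D : {set J}) (phi : {ffun J -> T} -> T -> R) (t0 : T) :
  (forall X Y : {ffun J -> T}, (forall j, j \notin D -> X j = Y j) -> phi X = phi Y) ->
  (forall X t, 0 <= phi X t) ->
  (forall X j, j \in D -> mean (w j) (phi X) <= 1) ->
  \sum_(X : {ffun J -> T}) (\prod_j w j (X j)) * \prod_(j in D) phi X (X j) <= 1.
Proof.
move=> phiD phi0 phi1; rewrite -[X in _ <= X]prod_dist_total.
(* A fibre of [pr] fixes the coordinates outside [D] and lets the others run freely; the value [t0]
   on [D] marks its representative. *)
pose pr (X : {ffun J -> T}) := [ffun j => if j \in D then t0 else X j].
rewrite (partition_big pr predT) //= [X in _ <= X](partition_big pr predT) //=.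
apply: ler_sum => Y _.
case: (eqVneq (pr Y) Y) => [prY|prY]; last first.
  have nY X : (pr X == Y) = false.
    apply/negP => /eqP XY; case/eqP: prY.
    by rewrite -XY; apply/ffunP => j; rewrite !ffunE; case: (j \in D).
  by rewrite !big_pred0.
pose Q j := [pred t | (j \in D) || (t == Y j)].
have QE X : (pr X == Y) = (X \in family Q).
  apply/eqP/familyP => [XY j|XQ].
    by rewrite inE -XY ffunE; case: (j \in D) => //=.
  apply/ffunP => j; have := XQ j; rewrite inE ffunE.
  have := congr1 (fun Z : {ffun J -> T} => Z j) prY; rewrite /= ffunE.
  by case: (boolP (j \in D)) => //= jD _ /eqP.
have phiY X : pr X == Y -> phi X = phi Y.
  by move=> /eqP <-; apply: phiD => j /negbTE jD; rewrite ffunE jD.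
rewrite (eq_bigr (fun X : {ffun J -> T} =>
    \prod_j (w j (X j) * if j \in D then phi Y (X j) else 1))); last first.
  by move=> X /phiY ->; rewrite big_split /= -big_mkcond.
rewrite !(eq_bigl _ _ QE).
rewrite -(bigA_distr_big_dep (fun j => Q j)
  (fun j t => w j t * if j \in D then phi Y t else 1)).
rewrite -(bigA_distr_big_dep (fun j => Q j) (fun j t => w j t)).
apply: ler_prod => j _; apply/andP; split.
  by apply: sumr_ge0 => t _; rewrite mulr_ge0 ?(dw j).1 //; case: ifP.
rewrite /=; case: (boolP (j \in D)) => jD; last first.
  by under eq_bigr do rewrite mulr1.
by rewrite (dw j).2; apply: phi1.
Qed.

End Resampling.

(** * Bernstein inequality with a fixed exponent, and the union bound *)

Section Chernoff.
Variable R : realType.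

(** Follows from [expR x <= 1 / (1 - x)] and [(1 + x + 2 x^2) (1 - x) = 1 + x^2 (1 - 2 x)]. *)
Lemma expR_le_quad (x : R) : x <= 2^-1 -> expR x <= 1 + x + 2 * x ^+ 2.
Proof.
move=> x2; have : 1 - x <= expR (- x) by exact: expR_ge1Dx.
have x1 : 0 < 1 - x by lra.
rewrite expRN -ler_pV2 ?inE ?unitfE ?invr_gt0 ?expR_gt0 ?lt0r_neq0 ?invr_gt0 ?expR_gt0 //.
rewrite invrK => /le_trans; apply.
rewrite -[leLHS]mul1r ler_pdivrMr //.
have : 0 <= x ^+ 2 * (1 - 2 * x) by rewrite mulr_ge0 ?sqr_ge0 //; lra.
suff -> : (1 + x + 2 * x ^+ 2) * (1 - x) = 1 + x ^+ 2 * (1 - 2 * x) by lra.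
by ring.
Qed.

(** The linear term of the exponential has mean zero, and the quadratic one is paid for by the
    second moment inside the exponent. As [l] is fixed in advance, that second moment may depend on
    the remaining samples. *)
Lemma mgf_le1 (T : finType) (p f : T -> R) (M l c : R) :
  is_dist p -> (forall x y, f x <= f y + M) -> 0 <= l -> l * M <= 2^-1 ->
  mean p (fun t => expR (l * (f t - mean p f)
     - 2 * l ^+ 2 * mean p (fun x => (f x - c) ^+ 2))) <= 1.
Proof.
move=> dp fM l0 lM; set m := mean p f; set q := mean p (fun x => _ ^+ 2).
rewrite (eq_mean p (g := fun t => expR (- (2 * l ^+ 2 * q)) * expR (l * (f t - m))));
  last by move=> t; rewrite -expRD addrC.
rewrite meanZ expRN mulrC ler_pdivrMr ?expR_gt0 // mul1r.
apply: le_trans (expR_ge1Dx _).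
have H t : expR (l * (f t - m)) <=
    1 + (l * (f t + - m) + 2 * l ^+ 2 * (f t - m) ^+ 2).
  apply: le_trans (expR_le_quad _) _; last by rewrite exprMn; lra.
  apply: le_trans lM; apply: ler_wpM2l => //.
  rewrite lerBlDr -lerBlDl; apply: mean_ge => // y.
  by rewrite lerBlDl addrC.
apply: le_trans (ler_mean dp H) _.
rewrite meanD mean_cst // lerD2l meanD !meanZ meanD !mean_cst // subrr mulr0 add0r.
by rewrite ler_wpM2l ?mulr_ge0 ?sqr_ge0 //; apply: variance_le.
Qed.

Variables (S A : finType) (P : S -> A -> S -> R) (n : nat).
Hypotheses (kP : is_kernel P) (n0 : (0 < n)%N).
Implicit Types X Y : {ffun S * A * 'I_n -> S}.

Lemma mean_emp_kernel X s a f :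
  mean (emp_kernel R X s a) f = n%:R^-1 * \sum_(k < n) f (X (s, a, k)).
Proof.
rewrite /mean /emp_kernel big_distrr /=.
under eq_bigr => x _.
  rewrite -sum1_card natr_sum [_ / _]mulrC -mulrA big_distrl /=.
  rewrite big_mkcond /= big_distrr /=.
  over.
rewrite exchange_big /=; apply: eq_bigr => k _.
rewrite (bigD1 (X (s, a, k))) //= inE eqxx mul1r big1 ?addr0 // => x xX.
by rewrite inE eq_sym (negbTE xX) mulr0.
Qed.

Lemma is_kernel_emp X : is_kernel (emp_kernel R X).
Proof.
move=> s a; split=> [x|]; first by rewrite divr_ge0.
have := mean_emp_kernel X s a (fun=> 1); rewrite sumr_const card_ord.
rewrite mulVf ?pnatr_eq0 -?lt0n // => <-.
by apply: eq_bigr => x _; rewrite mulr1.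
Qed.

Lemma sample_prob_total : sample_prob P (fun _ : {ffun S * A * 'I_n -> S} => True) = 1.
Proof.
rewrite -(prod_dist_total (w := fun j : S * A * 'I_n => P j.1.1 j.1.2)
  (fun j => kP j.1.1 j.1.2)).
by apply: eq_bigr => X _; rewrite asboolT // mulr1.
Qed.

Lemma le_sample_prob (E E' : {ffun S * A * 'I_n -> S} -> Prop) :
  (forall X, E X -> E' X) -> sample_prob P E <= sample_prob P E'.
Proof.
move=> EE; apply: ler_sum => X _; rewrite ler_wpM2l //.
  by apply: prodr_ge0 => j _; apply: (kP _ _).1.
by rewrite ler_nat; case: asboolP => //= EX; rewrite asboolT //; apply: EE.
Qed.

Lemma union_bound (I : finType) (B : I -> {ffun S * A * 'I_n -> S} -> Prop)
    (E : {ffun S * A * 'I_n -> S} -> Prop) (b : R) :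
  (forall X, (forall i, ~ B i X) -> E X) ->
  (forall i, sample_prob P (B i) <= b) ->
  1 - #|I|%:R * b <= sample_prob P E.
Proof.
move=> BE Bb; rewrite lerBlDr -[leLHS]sample_prob_total.
have : \sum_(i : I) sample_prob P (B i) <= \sum_(i : I) b by apply: ler_sum.
rewrite sumr_const -[b *+ _]mulr_natl => Bs.
apply: le_trans (lerD (lexx _) Bs).
rewrite /sample_prob exchange_big -big_split /=; apply: ler_sum => X _.
rewrite -big_distrr -mulrDr /= ler_wpM2l //.
  by apply: prodr_ge0 => j _; apply: (kP _ _).1.
rewrite asboolT //; case: (asboolP (E X)) => [_|nE].
  by rewrite lerDl; apply: sumr_ge0.
rewrite add0r; have [i Bi] : exists i, B i X.
  by apply: contrapT => nB; apply: nE; apply: BE => i Bi; apply: nB; exists i.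
by rewrite (bigD1 i) //= asboolT // lerDl; apply: sumr_ge0.
Qed.

(** The function [f] may be random as long as it ignores the samples of [(s, a)]: given all other
    samples, these are still independent draws from [P s a]. *)
Lemma chernoff (s : S) (a : A) (f : {ffun S * A * 'I_n -> S} -> S -> R) (M l L : R) :
  (forall X Y, (forall j, j.1 != (s, a) -> X j = Y j) -> f X = f Y) ->
  (forall X x y, f X x <= f X y + M) -> 0 < l -> l * M <= 2^-1 ->
  sample_prob P (fun X => mean (P s a) (f X)
      + (2 * l * mean (P s a) (fun x => (f X x - f X s) ^+ 2) + L / (n%:R * l))
      < mean (emp_kernel R X s a) (f X)) <= expR (- L).
Proof.
move=> fD fM l0 lM.
have nR : 0 < n%:R :> R by rewrite ltr0n.
pose q X := mean (P s a) (fun x => (f X x - f X s) ^+ 2).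
pose phi X t := expR (l * (f X t - mean (P s a) (f X)) - 2 * l ^+ 2 * q X).
pose D := [set j : S * A * 'I_n | j.1 == (s, a)].
have H := prod_resample (w := fun j : S * A * 'I_n => P j.1.1 j.1.2)
  (fun j => kP j.1.1 j.1.2) (D := D) (phi := phi) s _ (fun _ _ => expR_ge0 _) _.
rewrite -[leRHS]mulr1; apply: le_trans (ler_wpM2l (expR_ge0 _) (H _ _)); last 2 first.
- move=> X Y XY; have fXY : f X = f Y.
    by apply: fD => j jsa; apply: XY; rewrite inE.
  by rewrite /phi /q fXY.
- move=> X j; rewrite inE => /eqP -> /=.
  by apply: (mgf_le1 (M := M)) => //; exact: ltW.
(* Markov's inequality: on the deviation event, [expR (- L)] times the product of the [phi] is at
   least 1. *)
rewrite big_distrr; apply: ler_sum => X _ /=.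
rewrite [leRHS]mulrCA ler_wpM2l //; first by apply: prodr_ge0 => j _; apply: (kP _ _).1.
case: asboolP => [EX|_]; last by rewrite mulr_ge0 ?expR_ge0 ?prodr_ge0 // => j _; apply: expR_ge0.
have -> : \prod_(j in D) phi X (X j) = expR (\sum_(k < n)
    (l * (f X (X (s, a, k)) - mean (P s a) (f X)) - 2 * l ^+ 2 * q X)).
  rewrite expR_sum (reindex_onto (fun k : 'I_n => (s, a, k)) (fun j => j.2)) /=.
    by apply: eq_bigl => k; rewrite inE !eqxx.
  by move=> [[s' a'] k]; rewrite inE => /eqP[-> ->].
rewrite -expRD -[leLHS]expR0 ler_expR.
rewrite big_split /= -big_distrr /= big_split /= !sumr_const card_ord.
move: EX; rewrite mean_emp_kernel -/(q X).
set m := mean _ _; set F := \sum_(i < n) _ => EX.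
have {EX} : n%:R * l * (m + (2 * l * q X + L / (n%:R * l))) <= n%:R * l * (n%:R^-1 * F).
  by rewrite ler_pM2l ?mulr_gt0 // ltW.
have -> : n%:R * l * (m + (2 * l * q X + L / (n%:R * l))) =
    n%:R * l * m + 2 * n%:R * l ^+ 2 * q X + L.
  by field; rewrite !lt0r_neq0.
have -> : n%:R * l * (n%:R^-1 * F) = l * F by field; rewrite lt0r_neq0.
rewrite -subr_ge0 => /le_trans; apply.
by rewrite le_eqVlt; apply/orP; left; apply/eqP; ring.
Qed.

End Chernoff.

(** * From one-step concentration to gain bounds *)

Section Deterministic.
Variables (R : realType) (S A : finType) (P : S -> A -> S -> R).
Variables (r : S -> A -> R) (g M th l : R).
Hypotheses (kP : is_kernel P) (r01 : forall s a, 0 <= r s a <= 1).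
Hypotheses (g01 : 0 <= g < 1) (th0 : 0 <= th) (th1 : th <= 96^-1).
Hypotheses (l0 : 0 <= l) (lM : l * M = th).
Implicit Types (Q : S -> A -> S -> R) (V U h : S -> R).

Lemma is_policy_det (d : S -> A) : is_policy (det_policy R d).
Proof.
move=> s; split=> [a|]; first by rewrite /det_policy ler0n.
by rewrite (bigD1 (d s)) //= /det_policy eqxx big1 ?addr0 // => a /negbTE ->.
Qed.

Lemma kop_Ppi (pi : S -> A -> R) V s :
  kop (Ppi P pi) V s = mean (pi s) (fun a => mean (P s a) V).
Proof.
rewrite /kop /mean /Ppi; under eq_bigr do rewrite big_distrl /=.
rewrite exchange_big /=; apply: eq_bigr => a _.
by rewrite big_distrr /=; apply: eq_bigr => x _; rewrite mulrA.
Qed.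

Lemma mean_det (d : S -> A) s (F : A -> R) : mean (det_policy R d s) F = F (d s).
Proof.
rewrite /mean (bigD1 (d s)) //= /det_policy eqxx mul1r big1 ?addr0 // => a /negbTE ->.
by rewrite mul0r.
Qed.

(** Splits the centred second moment into a part that telescopes and a part driven by the one-step
    drift of [V]. *)
Lemma kop_sqr_center (pi : S -> A -> R) V s : is_policy pi ->
  kop (Ppi P pi) (fun x => (V x - V s) ^+ 2) s =
  (kop (Ppi P pi) (fun x => V x ^+ 2) s - V s ^+ 2) +
  2 * (V s * (V s - kop (Ppi P pi) V s)).
Proof.
move=> ppi; rewrite /kop (mean_sqr_center _ _ (is_dist_Ppi kP ppi s)); ring.
Qed.

(* The centred second moment of [V] along the chain is a coboundary plus
   [2 V' (V' - K V')], and [V' - K V' <= 1 + small]: on average it is [O(M)], which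
   is why the error is linear rather than quadratic in the span. *)
Lemma gain_lower Q V (d : S -> A) :
  is_kernel Q -> (forall s, 0 <= V s) -> (forall x y, V x <= V y + M) ->
  (forall s, V s <= r s (d s) + g * mean (Q s (d s)) V + th) ->
  (forall s, mean (Q s (d s)) V <= mean (P s (d s)) V +
     (4 * l * mean (P s (d s)) (fun x => (V x - V s) ^+ 2) + 6 * th)) ->
  forall s, (1 - g) * fmin V - 25 * th <= gain P r (det_policy R d) s.
Proof.
have t0 := th0; have t96 := th1.
move=> kQ V0 VM Vstep VD; pose pi := det_policy R d.
have ppi : is_policy pi by exact: is_policy_det.
pose V' x := V x - fmin V.
(* The term [g * V] matches the discounted Bellman equation. The coefficient [8 l] is twice that of
   the second moment in the hypothesis, which leaves slack for the products with [th]. *)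
pose W x := g * V x + 8 * l * V' x ^+ 2.
apply: (gain_ge kP ppi (W := W)) => s.
have kopE F : kop (Ppi P pi) F s = mean (P s (d s)) F.
  by rewrite kop_Ppi mean_det.
have -> : rpi r pi s = r s (d s) by exact: mean_det.
rewrite kopE; set p := P s (d s); have dp : is_dist p by exact: kP.
have /andP[rs0 rs1] := r01 s (d s); have /andP[g0 g1] := g01.
have V'0 : 0 <= V' s by rewrite subr_ge0 fmin_le.
have V'M : V' s <= M.
  by rewrite lerBlDr addrC -lerBlDr; apply: (le_fmin s) => x; rewrite lerBlDr.
set q := mean p (fun x => (V x - V s) ^+ 2) in VD.
have q0 : 0 <= q by apply: mean_ge => // x; exact: sqr_ge0.
set dK := mean p (fun x => V' x ^+ 2) - V' s ^+ 2.
have PV0 : 0 <= mean p V by apply: mean_ge.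
have V'P : V' s - mean p V' = V s - mean p V.
  by rewrite meanD mean_cst // /V'; ring.
have qE : q = dK + 2 * (V' s * (V s - mean p V)).
  have := kop_sqr_center V' s ppi; rewrite !kopE -/p -/dK V'P => <-.
  by apply: eq_mean => x; rewrite /V'; congr (_ ^+ 2); ring.
have {VD}VD := VD s; have {Vstep}Vstep := Vstep s; rewrite -/p -/q in VD Vstep.
set e := 4 * l * q + 6 * th in VD.
have e0 : 0 <= e by rewrite addr_ge0 ?mulr_ge0.
have Ve : V s <= r s (d s) + g * mean p V + e + th.
  apply: le_trans Vstep _; rewrite lerD2r -addrA lerD2l.
  apply: le_trans (ler_wpM2l g0 VD) _; rewrite mulrDr lerD2l.
  by rewrite ler_piMl // ltW.
have VP : V s - mean p V <= 1 + e + th.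
  have : g * mean p V <= mean p V by rewrite ler_piMl // ltW.
  by lra.
have VV : V' s * (V s - mean p V) <= M * (1 + e + th).
  apply: le_trans (ler_wpM2l V'0 VP) _; apply: ler_wpM2r => //.
  by rewrite addr_ge0 // addr_ge0.
have M0 : 0 <= M by apply: le_trans V'M.
(* The drift bound contains [q] again, but with a factor [8 th <= 1/12], so it can be absorbed on
   the left. *)
have lq : l * q <= l * dK + 2 * th * (1 + 4 * (l * q) + 7 * th).
  have := ler_wpM2l l0 VV; rewrite [l * (M * _)]mulrA lM => H.
  rewrite {1}qE mulrDr lerD2l.
  have -> : l * (2 * (V' s * (V s - mean p V))) = 2 * (l * (V' s * (V s - mean p V))).
    by ring.
  rewrite -mulrA ler_pM2l //; apply: le_trans H _.
  by rewrite le_eqVlt /e; apply/orP; left; apply/eqP; ring.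
have lq0 : 0 <= l * q by rewrite mulr_ge0.
have t1 : th * (l * q) <= 96^-1 * (l * q) by rewrite ler_wpM2r.
have t2 : th * th <= 96^-1 * th by rewrite ler_wpM2r.
have {}lq : l * q <= l * dK + 2 * th + 8 * (th * (l * q)) + 14 * (th * th).
  by apply: le_trans lq _; rewrite le_eqVlt; apply/orP; left; apply/eqP; ring.
have gV : (1 - g) * fmin V <= (1 - g) * V s.
  by rewrite ler_wpM2l ?fmin_le // subr_ge0 ltW.
have -> : (1 - g) * fmin V - 25 * th + (W s - mean p W) =
    (1 - g) * fmin V + g * V s - g * mean p V - 25 * th - 8 * (l * dK).
  by rewrite /W meanD !meanZ /dK; ring.
have eE : e = 4 * (l * q) + 6 * th by rewrite /e mulrA.
move: (l * q) (l * dK) lq0 t1 lq eE => L D lq0 t1 lq eE; lra.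
Qed.

(** The square in [f] gains [8 l] times the second moment of [h]. Concentration costs [2 l] times
    that of [f], hence at most [8 l] times that of [h], because increments of [f] are at most twice
    those of [h]. The two cancel up to [O(th)]. *)
Lemma value_lower Q (pi : S -> A -> R) (rho : R) h k s :
  is_kernel Q -> is_policy pi -> 0 <= rho <= 1 ->
  (forall x, 0 <= h x <= M / 2) ->
  (forall x, rho + h x <= rpi r pi x + kop (Ppi P pi) h x) ->
  let f x := h x + 8 * l * h x ^+ 2 in
  (forall x a, mean (P x a) f <= mean (Q x a) f +
     (2 * l * mean (P x a) (fun y => (f y - f x) ^+ 2) + th)) ->
  rho - 9 * th - (1 - g) * M - g ^+ k * (1 + (1 - g) * M) <=
    (1 - g) * viter r g M Q k s.
Proof.
have t0 := th0; have t96 := th1.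
move=> kQ ppi /andP[rho0 rho1] hM hsub f fD.
have /andP[g0 g1] := g01; have g1' : 0 < 1 - g by rewrite subr_gt0.
have h0 x : 0 <= h x by case/andP: (hM x).
have M0 : 0 <= M by have := hM s; lra.
have lh x : 8 * (l * h x) <= 24^-1.
  have : l * h x <= l * (M / 2) by rewrite ler_wpM2l //; case/andP: (hM x).
  by rewrite [l * (M / 2)]mulrA lM; move: (l * h x) => y; lra.
have lh0 x : 0 <= l * h x by rewrite mulr_ge0.
have fE x : f x = h x * (1 + 8 * (l * h x)) by rewrite /f; ring.
have f0 x : 0 <= f x by rewrite fE mulr_ge0 // addr_ge0 // mulr_ge0.
have fM x : f x <= M.
  have : f x <= h x * 2 by rewrite fE; apply: ler_wpM2l => //; have := lh x;
      move: (l * h x) => y; lra.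
  by have := hM x; lra.
(* [(1 - g) K] spends all the slack: [8 th] from the drift of [h], [th] from concentration, and
   [(1 - g) M] from discounting the mean of [f]. *)
pose K := (rho - 9 * th - (1 - g) * M) / (1 - g).
have KE : (1 - g) * K = rho - 9 * th - (1 - g) * M.
  by rewrite mulrC divfK // lt0r_neq0.
pose U x := K + f x.
have fq x a : mean (P x a) (fun y => (f y - f x) ^+ 2) <=
    4 * mean (P x a) (fun y => (h y - h x) ^+ 2).
  rewrite -meanZ; apply: ler_mean => [|y]; first exact: kP.
  have -> : f y - f x = (h y - h x) * (1 + 8 * (l * h y) + 8 * (l * h x)).
    by rewrite /f; ring.
  rewrite exprMn mulrC ler_wpM2r ?sqr_ge0 //.
  have -> : 4 = 2 ^+ 2 :> R by ring.
  by apply: lerXn2r; rewrite ?nnegrE; have := lh x; have := lh y;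
     have := lh0 x; have := lh0 y; move: (l * h x) (l * h y) => u v; lra.
have Ub x : U x <= bellman Q r g U x.
  have : mean (pi x) (qvalue r g Q U x) <= bellman Q r g U x.
    apply: mean_le => [|a]; first exact: ppi.
    exact: (le_fmax (fun a => qvalue r g Q U x a)).
  apply: le_trans.
  set m := mean (pi x) (fun a => mean (Q x a) f).
  have -> : mean (pi x) (qvalue r g Q U x) = rpi r pi x + g * (K + m).
    rewrite /m -(mean_cst K (ppi x)) -meanD -meanZ -meanD.
    by apply: eq_mean => a; rewrite /qvalue /U meanD !mean_cst.
  have mM : m <= M.
    by apply: mean_le => [|a]; [exact: ppi | apply: mean_le].
  have rx : rpi r pi x <= 1.
    by apply: (mean_le (ppi x)) => a; case/andP: (r01 x a).
  pose k2 := kop (Ppi P pi) (fun y => h y ^+ 2) x.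
  have mlow : kop (Ppi P pi) f x <=
      m + (8 * l * kop (Ppi P pi) (fun y => (h y - h x) ^+ 2) x + th).
    rewrite !kop_Ppi -meanZ; rewrite -[X in _ + (_ + X)](mean_cst th (ppi x)) -!meanD.
    apply: ler_mean => [|a]; first exact: ppi.
    apply: le_trans (fD x a) _; rewrite lerD2l lerD2r.
    apply: le_trans (ler_wpM2l _ (fq x a)) _; first by rewrite mulr_ge0.
    by rewrite le_eqVlt; apply/orP; left; apply/eqP; ring.
  have fkop : kop (Ppi P pi) f x = kop (Ppi P pi) h x + 8 * l * k2.
    by rewrite /kop meanD meanZ.
  have lk : l * kop (Ppi P pi) (fun y => (h y - h x) ^+ 2) x <=
      l * (k2 - h x ^+ 2) + th.
    rewrite kop_sqr_center // mulrDr lerD2l -lM ler_wpM2l //.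
    have : h x * (h x - kop (Ppi P pi) h x) <= h x * 1.
      by rewrite ler_wpM2l //; have := hsub x; lra.
    by have := hM x; lra.
  have gm : (1 - g) * m <= (1 - g) * M by rewrite ler_wpM2l // ltW.
  have -> : rpi r pi x + g * (K + m) =
      rpi r pi x + K + m - (1 - g) * K - (1 - g) * m by ring.
  rewrite mulrBr in lk.
  have UE : U x = K + h x + 8 * (l * h x ^+ 2) by rewrite /U /f; ring.
  rewrite UE KE; move: mlow; rewrite fkop -![8 * l * _]mulrA.
  move: gm lk; have := hsub x.
  move: (l * k2) (l * h x ^+ 2) (l * kop _ _ _) ((1 - g) * m) ((1 - g) * M).
  by move=> A1 B1 C1 D1 E1; lra.
(* Since [0 <= f <= M], the span of [U] is at most [M] and clipping never cuts below [U]. *)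
have Ustep x : U x <= vstep r g M Q U x.
  rewrite /vstep /clip le_min Ub /= addrC -lerBlDr; apply: (le_fmin x) => y.
  apply: le_trans (Ub y); rewrite lerBlDr -addrA lerD2l.
  by apply: le_trans (fM x) _; rewrite lerDr.
have KU x : U x <= (1 - g)^-1 + M.
  rewrite lerD // /K -[leRHS]mul1r ler_wpM2r ?invr_ge0 ?(ltW g1') //.
  have : 0 <= (1 - g) * M by rewrite mulr_ge0 // ltW.
  by move: (_ * M) => E1; lra.
have B0 : 0 <= (1 - g)^-1 + M by rewrite addr_ge0 ?invr_ge0 // ltW.
have := viter_lower g01 k s kQ Ustep B0 KU.
move/(ler_wpM2l (ltW g1')); rewrite {1}/U [X in X <= _]mulrDr KE [X in _ <= X]mulrDr.
have -> : (1 - g) * (g ^+ k * ((1 - g)^-1 + M)) = g ^+ k * (1 + (1 - g) * M).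
  by field; rewrite lt0r_neq0.
have : 0 <= (1 - g) * f s by rewrite mulr_ge0 // ltW.
by move: (g ^+ k * _) => a; move: ((1 - g) * M) ((1 - g) * f s) => b c; lra.
Qed.

(** Carries concentration from a pinned iterate [f'] to the actual iterate [f]. Squared increments
    at most double, up to [8 z^2]; [M >= 4] gives [l <= th / 4], which makes this last term
    negligible. *)
Lemma concentration_transfer (p q f f' : S -> R) s z :
  is_dist p -> is_dist q -> 4 <= M -> z <= 2 * th ->
  (forall x, `|f' x - f x| <= z) ->
  mean q f' <= mean p f' + (2 * l * mean p (fun x => (f' x - f' s) ^+ 2) + th) ->
  mean q f <= mean p f + (4 * l * mean p (fun x => (f x - f s) ^+ 2) + 6 * th).
Proof.
have t0 := th0; have t96 := th1.
move=> dp dq M4 zth ff fD.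
have z0 : 0 <= z by apply: le_trans (ff s).
have fz x : f' x <= f x + z /\ f x <= f' x + z.
  by have := ff x; rewrite ler_norml; lra.
have qf := ler_mean_shift dq (fun x => (fz x).2).
have pf := ler_mean_shift dp (fun x => (fz x).1).
have sq : mean p (fun x => (f' x - f' s) ^+ 2) <=
    2 * mean p (fun x => (f x - f s) ^+ 2) + 8 * z ^+ 2.
  rewrite -meanZ; apply: ler_mean_shift => // x.
  have : (f' x - f' s - (f x - f s)) ^+ 2 <= (2 * z) ^+ 2.
    rewrite -[leLHS]real_normK ?num_real //.
    apply: lerXn2r; rewrite ?nnegrE ?mulr_ge0 // ler_norml.
    by have := fz x; have := fz s; lra.
  set a := f' x - f' s; set b := f x - f s => H.
  have : 0 <= (2 * b - a) ^+ 2 by exact: sqr_ge0.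
  have -> : (2 * b - a) ^+ 2 = 2 * (a - b) ^+ 2 + 2 * b ^+ 2 - a ^+ 2 by ring.
  move: H; have -> : (2 * z) ^+ 2 = 4 * z ^+ 2 by ring.
  by lra.
have lth : l <= th / 4.
  have : l * 4 <= l * M by rewrite ler_wpM2l.
  by rewrite lM; lra.
have z2 : z ^+ 2 <= 1 / 24 ^+ 2.
  rewrite -(expr1n R 2) -expr_div_n.
  by apply: lerXn2r; rewrite ?nnegrE; lra.
have lz : l * z ^+ 2 <= th / 4 * (1 / 24 ^+ 2).
  by apply: ler_pM => //; exact: sqr_ge0.
have := ler_wpM2l l0 sq; rewrite mulrDr.
move: fD; rewrite -!mulrA.
set u := l * mean p _; set v := l * (2 * _).
have -> : v = 2 * (l * mean p (fun x => (f x - f s) ^+ 2)) by rewrite /v; ring.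
set w := l * mean p _.
have -> : l * (8 * z ^+ 2) = 8 * (l * z ^+ 2) by ring.
lra.
Qed.

End Deterministic.

(** * The parameters of the algorithm *)

Section Schedule.
Variable R : realType.

Lemma ln2_gt0 : 0 < ln 2 :> R.
Proof. by rewrite -ln1 ltr_ln ?posrE // ltr1n. Qed.

Lemma le_log2 (y : R) c : 2 ^+ c <= y -> c%:R <= log2 y.
Proof.
move=> cy; rewrite /log2 ler_pdivlMr ?ln2_gt0 // mulr_natl -lnXn //.
rewrite ler_ln ?posrE ?exprn_gt0 //.
by apply: lt_le_trans cy; rewrite exprn_gt0.
Qed.

Lemma esp_indexE n i : (0 < n)%N ->
  esp_index R n i = (2 <= i)%N && (2 ^ i.-1 < n)%N.
Proof.
case: i => [|i] n0 //; rewrite /esp_index; congr andb => /=.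
rewrite -addn1 PoszD lezD1 ceil_gt_int /log2 ltr_pdivlMr ?ln2_gt0 //.
rewrite -[_%:~R]/(i%:R) mulr_natl -lnXn // ltr_ln ?posrE ?exprn_gt0 ?ltr0n //.
by rewrite -natrX ltr_nat.
Qed.

(** Uses [g <= expR (g - 1)]; the horizon is chosen so that the resulting exponential inverts the
    logarithm. *)
Lemma plan_T_pow (g eps : R) : 0 <= g < 1 -> 0 < eps <= 1 ->
  g ^+ plan_T g eps <= (1 - g) ^+ 2 * eps / 3.
Proof.
move=> /andP[g0 g1] /andP[e0 e1].
have g1' : 0 < 1 - g by rewrite subr_gt0.
set y := 3 / ((1 - g) ^+ 2 * eps).
have y0 : 0 < y by rewrite divr_gt0 // mulr_gt0 // exprn_gt0.
have Tge : ln y / (1 - g) <= (plan_T g eps)%:R.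
  rewrite /plan_T natr_absz; apply: le_trans (ceil_ge _) _.
  by rewrite ler_int ler_norm.
have gexp : g <= expR (g - 1).
  by have := expR_ge1Dx (g - 1); rewrite addrC subrK.
apply: le_trans (lerXn2r _ _ _ gexp) _; rewrite ?nnegrE ?expR_ge0 //.
rewrite -expRM_natl.
have -> : (1 - g) ^+ 2 * eps / 3 = expR (- ln y).
  by rewrite expRN lnK ?posrE // invf_div.
rewrite ler_expR; move: Tge; rewrite ler_pdivrMr // => Tge.
by rewrite -opprB mulrN lerN2.
Qed.

End Schedule.

(** * Sizes of the logarithm, [alpha], [theta] and the discount factors *)

Section Sizes.
Variables (R : realType) (S A : finType) (delta : R) (n : nat).
Hypotheses (S0 : (0 < #|S|)%N) (A0 : (0 < #|A|)%N).
Hypotheses (d01 : 0 < delta < 1) (n0 : (0 < n)%N).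

Definition log_size : R := ln (24 * #|S|%:R * #|A|%:R * n%:R ^+ 5 / delta).

Local Notation L := log_size.
Local Notation al := (alpha S A delta n).

Let nR : 1 <= n%:R :> R. Proof. by rewrite ler1n. Qed.

Let size_ge : 24 <= 24 * #|S|%:R * #|A|%:R * n%:R ^+ 5 / delta.
Proof.
case/andP: d01 => d0 d1; rewrite ler_pdivlMr // -!mulrA.
apply: ler_wpM2l => //; apply: le_trans (ltW d1) _.
by rewrite -natrX -!natrM ler1n !(muln_gt0 #|_|) S0 A0 expn_gt0 n0.
Qed.

Let size_gt0 : 0 < 24 * #|S|%:R * #|A|%:R * n%:R ^+ 5 / delta.
Proof. exact: lt_le_trans size_ge. Qed.

Lemma log_size_ge1 : 1 <= L.
Proof.
rewrite -[1]expRK ler_ln ?posrE ?expR_gt0 //; apply: le_trans size_ge.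
(* [expR (- 1/2) >= 1/2] gives [expR 1 <= 4], well below 24. *)
have := expR_ge1Dx (- (2^-1) : R); have := expRxMexpNx_1 (2^-1 : R).
have -> : expR 1 = expR 2^-1 * expR 2^-1 :> R by rewrite -expRD; congr expR; lra.
have := expR_gt0 (2^-1 : R); have := expR_gt0 (- 2^-1 : R).
move: (expR (- 2^-1)) (expR 2^-1) => a b a0 b0 ab a2.
have : b <= 2 by rewrite -(ler_pM2r a0) ab; lra.
move=> b2; have := ler_pM (ltW b0) (ltW b0) b2 b2; lra.
Qed.

Lemma expRN_log_size :
  expR (- L) = delta / (24 * #|S|%:R * #|A|%:R * n%:R ^+ 5).
Proof. by rewrite expRN lnK ?posrE // invf_div. Qed.

(** The iterated logarithm is at least 1 because [n + 4 >= 4]. *)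
Lemma alpha_ge : 96 * Num.sqrt L <= al.
Proof.
rewrite /alpha -[leLHS]mulr1 ler_wpM2l ?mulr_ge0 ?sqrtr_ge0 //.
apply: (@le_log2 _ _ 1); apply: (@le_log2 _ _ 2).
by rewrite (_ : 2 ^+ 2 = 4) ?lerDr ?ler0n // -natrX.
Qed.

Lemma alpha_ge96 : 96 <= al.
Proof.
apply: le_trans alpha_ge; rewrite ler_peMr // -[leLHS]sqrtr1 ler_sqrt ?log_size_ge1 //.
exact: le_trans ler01 log_size_ge1.
Qed.

Variable i : nat.
Local Notation M := (esp_M R i).
Local Notation g := (esp_gamma S A delta n i).

Definition theta : R := Num.sqrt (L * M / n%:R).

Lemma esp_M_gt0 : 0 < M.
Proof. by rewrite /esp_M exprn_gt0. Qed.

Let nR0 : 0 < n%:R :> R. Proof. by rewrite ltr0n. Qed.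
Let M0 := esp_M_gt0.
Let al0 : 0 < al. Proof. exact: lt_le_trans alpha_ge96. Qed.
Let L0 : 0 < L. Proof. exact: (lt_le_trans ltr01 log_size_ge1). Qed.

Lemma theta_gt0 : 0 < theta.
Proof. by rewrite sqrtr_gt0 divr_gt0 // mulr_gt0. Qed.

Lemma theta_le : 96 * theta <= al * Num.sqrt (M / n%:R).
Proof.
rewrite /theta -mulrA sqrtrM ?(ltW L0) // mulrA ler_wpM2r ?sqrtr_ge0 //.
exact: alpha_ge.
Qed.

Lemma theta_sqr : theta ^+ 2 = L * M / n%:R.
Proof. by rewrite sqr_sqrtr // ltW // divr_gt0 // mulr_gt0. Qed.

(** Explains the exponent [theta / M]: it makes the additive Bernstein term equal to [theta]. *)
Lemma theta_div : L / (n%:R * (theta / M)) = theta.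
Proof.
apply: (mulIf (lt0r_neq0 theta_gt0)); rewrite -expr2 theta_sqr.
by field; rewrite !lt0r_neq0 // theta_gt0.
Qed.

Lemma invn_le_theta : n%:R^-1 <= theta.
Proof.
have nn : 0 <= n%:R^-1 :> R by rewrite invr_ge0 ltW.
rewrite -[leLHS]ger0_norm // -sqrtr_sqr ler_sqrt; last by rewrite divr_ge0 ?mulr_ge0 ?(ltW L0) ?(ltW M0).
rewrite expr2 ler_wpM2r //; apply: (@le_trans _ _ 1).
  by rewrite invf_le1.
rewrite -[leLHS]mulr1; apply: ler_pM => //; first exact: log_size_ge1.
by rewrite /esp_M exprn_ege1 // ler1n.
Qed.

Let x := Num.sqrt (n%:R * M) / (2 * Num.sqrt 2 * al).

Let gE : 1 - g = (Num.max x 1)^-1.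
Proof. by rewrite /esp_gamma opprB addrC subrK. Qed.

Let x1 : 1 <= Num.max x 1. Proof. by rewrite le_max lexx orbT. Qed.

Lemma esp_gamma01 : 0 <= g < 1.
Proof.
have m0 : 0 < (Num.max x 1)^-1 by rewrite invr_gt0 (lt_le_trans ltr01).
have m1 : (Num.max x 1)^-1 <= 1 by rewrite invf_le1 // (lt_le_trans ltr01).
by have := gE; lra.
Qed.

Let s2 : 1 <= Num.sqrt (2 : R) <= 3 / 2.
Proof.
apply/andP; split; first by rewrite -[leLHS]sqrtr1 ler_sqrt // ler1n.
rewrite -[leRHS]ger0_norm; last by lra.
by rewrite -sqrtr_sqr ler_sqrt; lra.
Qed.

Let sq0 : 0 < 2 * Num.sqrt (2 : R) * al.
Proof. by apply: mulr_gt0 => //; rewrite mulr_gt0 // sqrtr_gt0. Qed.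

(** Keeps the values below [n], so that a grid of mesh [1 / n] with [n^2 + 1] points covers them. *)
Lemma esp_horizon_le : M <= 2 * n%:R -> (1 - g)^-1 <= n%:R.
Proof.
move=> M2; rewrite gE invrK ge_max nR andbT /x.
case/andP: s2 => s21 _.
rewrite ler_pdivrMr //; apply: (@le_trans _ _ (2 * n%:R)).
  rewrite -[leRHS]ger0_norm ?mulr_ge0 // -sqrtr_sqr ler_sqrt; last first.
    by rewrite exprn_ge0 // mulr_ge0.
  have -> : (2 * n%:R) ^+ 2 = n%:R * (4 * n%:R) :> R by ring.
  by rewrite ler_wpM2l // (le_trans M2) // ler_wpM2r // ler_nat.
rewrite mulrC ler_wpM2l // -[leLHS]mulr1; apply: ler_pM => //.
  by rewrite ler_peMr.
by apply: le_trans alpha_ge96; rewrite ler1n.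
Qed.

(** The discount factor is tuned so that the discounting bias has the order of the statistical
    error; 3 bounds [2 sqrt 2]. *)
Lemma esp_gamma_span : (1 - g) * M <= 3 * (al * Num.sqrt (M / n%:R)).
Proof.
case/andP: s2 => s21 s22.
have sn : 0 < Num.sqrt (n%:R : R) by rewrite sqrtr_gt0.
have sM : 0 < Num.sqrt M by rewrite sqrtr_gt0.
have ss : 0 < Num.sqrt (2 : R) by rewrite sqrtr_gt0.
have x0 : 0 < x by apply: divr_gt0 => //; rewrite sqrtr_gt0 mulr_gt0.
apply: (@le_trans _ _ (x^-1 * M)).
  rewrite ler_wpM2r ?(ltW M0) // gE lef_pV2 ?posrE ?le_max ?lexx //.
  by apply: lt_le_trans x1.
rewrite /x invf_div sqrtrM ?(ltW nR0) // sqrtrM ?(ltW M0) // sqrtrV ?(ltW nR0) //.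
rewrite -{2}[M](sqr_sqrtr (ltW M0)).
have -> : 2 * Num.sqrt 2 * al / (Num.sqrt n%:R * Num.sqrt M) * Num.sqrt M ^+ 2 =
    (2 * Num.sqrt 2) * (al * (Num.sqrt M / Num.sqrt n%:R)).
  by field; rewrite !lt0r_neq0.
apply: ler_wpM2r; last by lra.
by apply: mulr_ge0 (ltW al0) _; rewrite divr_ge0 ?sqrtr_ge0.
Qed.

End Sizes.

(** * The algorithm *)

Section Algorithm.
Variables (R : realType) (S A : finType) (P : S -> A -> S -> R).
Variables (r : S -> A -> R) (delta : R) (n : nat).
Hypotheses (kP : is_kernel P) (r01 : forall s a, 0 <= r s a <= 1).
Hypotheses (S0 : (0 < #|S|)%N) (A0 : (0 < #|A|)%N).
Hypotheses (d01 : 0 < delta < 1) (n0 : (0 < n)%N).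
Implicit Types (X : {ffun S * A * 'I_n -> S}) (i : nat) (h : S -> R).

Local Notation L := (log_size S A delta n).
Local Notation al := (alpha S A delta n).
Local Notation M := (esp_M R).
Local Notation g := (esp_gamma S A delta n).
Local Notation th := (theta S A delta n).
Local Notation Phat := (emp_kernel R).

Let l i := th i / M i.
Let T i := plan_T (g i) (n%:R^-1 : R).

Let nR0 : 0 < n%:R :> R. Proof. by rewrite ltr0n. Qed.
Let g01 i : 0 <= g i < 1. Proof. exact: esp_gamma01. Qed.
Let M0 i : 0 < M i. Proof. exact: esp_M_gt0. Qed.
Let th0 i : 0 < th i. Proof. exact: theta_gt0. Qed.
Let l0 i : 0 < l i. Proof. exact: divr_gt0. Qed.
Let lM i : l i * M i = th i. Proof. by rewrite divfK // lt0r_neq0. Qed.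

Definition concentrates (p q f : S -> R) (c t : R) s :=
  mean q f <= mean p f + (2 * c * mean p (fun x => (f x - f s) ^+ 2) + t).

(** A Poisson inequality replaces the bias itself. The range [M i / 2] leaves room for the quadratic
    correction within the span [M i]. *)
Definition feasible i (rho : R) (pi : S -> A -> R) h :=
  [/\ is_policy pi, 0 <= rho <= 1, forall x, 0 <= h x <= M i / 2
    & forall x, rho + h x <= rpi r pi x + kop (Ppi P pi) h x].

(* One bias function per scale suffices, which avoids a union bound over
   policies. *)
Lemma near_optimal i : exists h, (forall x, 0 <= h x <= M i / 2) /\
  forall rho pi h', feasible i rho pi h' ->
    exists rho0 pi0, feasible i rho0 pi0 h /\ rho <= rho0 + n%:R^-1.
Proof.
have nV : 0 < n%:R^-1 :> R by rewrite invr_gt0.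
pose E := [set rho : R | exists pi h, feasible i rho pi h]%classic.
have [[rho1 [pi1 [h1 f1]]]|nE] := pselect (exists rho, E rho); last first.
  exists (fun=> 0); split=> [x|rho pi h' f].
    by rewrite lexx divr_ge0 // ltW.
  by case: nE; exists rho, pi, h'.
have ubE : ubound E 1 by move=> rho [pi [h [_ /andP[]]]].
have supE : has_sup E by split; [exists rho1, pi1, h1 | exists 1].
have [rho0 [pi0 [h [ppi0 rho01 hM hE]]] rho0E] := sup_adherent nV supE.
exists h; split=> // rho pi h' f; exists rho0, pi0; split; first by split.
have : rho <= sup E by apply: ub_le_sup; [exists 1 | exists pi, h'].
by lra.
Qed.

Definition anchor i : S -> R := projT1 (cid (near_optimal i)).

Lemma anchor_bound i x : 0 <= anchor i x <= M i / 2.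
Proof. exact: (projT2 (cid (near_optimal i))).1. Qed.

Lemma anchor_near_optimal i rho pi h : feasible i rho pi h ->
  exists rho0 pi0, feasible i rho0 pi0 (anchor i) /\ rho <= rho0 + n%:R^-1.
Proof. exact: (projT2 (cid (near_optimal i))).2. Qed.

Definition corrected i x := anchor i x + 8 * l i * anchor i x ^+ 2.

(** [Some k] gives the pinned iterates on the grid, for bounding the gain from below. [None] is
    negated because bounding the value from below needs the opposite deviation. *)
Definition test_fun i s a (o : option 'I_(n ^ 2).+1) X : S -> R :=
  if o is Some k then pin_iter r (g i) (M i) (s, a) (k%:R / n%:R) (Phat X) (T i)
  else fun x => - corrected i x.

Lemma test_fun_span i s a o X x y : th i <= 96^-1 ->
  test_fun i s a o X x <= test_fun i s a o X y + M i.
Proof.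
case: o => [k|] th96 /=; first by apply: pin_iter_span; exact: ltW.
have a0 z : 0 <= anchor i z by case/andP: (anchor_bound i z).
have aM z : anchor i z <= M i / 2 by case/andP: (anchor_bound i z).
have c0 : 0 <= corrected i x.
  by rewrite addr_ge0 // mulr_ge0 ?exprn_ge0 // mulr_ge0 // ltW.
suff : corrected i y <= M i by lra.
have -> : corrected i y = anchor i y * (1 + 8 * (l i * anchor i y)).
  by rewrite /corrected; ring.
have la : l i * anchor i y <= 192^-1.
  apply: le_trans (ler_wpM2l (ltW (l0 i)) (aM y)) _.
  by rewrite mulrA lM; lra.
have : anchor i y * (1 + 8 * (l i * anchor i y)) <= anchor i y * 2.
  by apply: ler_wpM2l => //; move: la; move: (l i * _) => z; lra.
by have := aM y; lra.
Qed.

(** Admissible scales satisfy [i < n], hence the finite range. Beyond [1/96] the final bounds hold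
    trivially and no concentration is requested. *)
Definition good X := forall (i : 'I_n) s a o, th i <= 96^-1 ->
  concentrates (P s a) (Phat X s a) (test_fun i s a o X) (l i) (th i) s.

Lemma good_prob : 1 - delta <= sample_prob P good.
Proof.
pose I : finType := ('I_n * S * A * option 'I_(n ^ 2).+1)%type.
pose B (z : I) X := let: (i, s, a, o) := z in th i <= 96^-1 /\
  ~ concentrates (P s a) (Phat X s a) (test_fun i s a o X) (l i) (th i) s.
have BE X : (forall z, ~ B z X) -> good X.
  move=> nB i s a o th96; apply: contrapT => nc.
  by apply: (nB (i, s, a, o)).
have Bb z : sample_prob P (B z) <= expR (- L).
  case: z => [[[i s] a] o]; case: (leP (th i) 96^-1) => th96; last first.
    rewrite /sample_prob big1 ?expR_ge0 // => X _.
    by rewrite asboolF ?mulr0 //= => -[]; rewrite leNgt th96.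
  apply: le_trans (@chernoff _ _ _ _ _ kP n0 s a (test_fun i s a o) (M i) (l i) L _ _ (l0 i) _).
  - apply: le_sample_prob => // X /= -[_ /negP].
    by rewrite -ltNge theta_div.
  - move=> X Y XY; rewrite /test_fun; case: o => // k.
    apply: eq_pin_iter => s' a' sa; apply/funext => x.
    rewrite /emp_kernel; congr (_%:R / _); apply: eq_card => j.
    by rewrite !inE XY.
  - by move=> X x y; apply: test_fun_span.
  - by rewrite lM; lra.
(* There are [n |S| |A| (n^2 + 2)] events, fewer than the [24 |S| |A| n^5] budgeted in the
   logarithm. *)
apply: le_trans (union_bound kP BE Bb); rewrite lerD2l lerN2.
rewrite expRN_log_size // !card_prod card_option !card_ord.
case/andP: d01 => d0 _.
have D0 : 0 < 24 * #|S|%:R * #|A|%:R * n%:R ^+ 5 :> R.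
  by rewrite !mulr_gt0 ?exprn_gt0 ?ltr0n.
rewrite mulrCA ler_piMr ?(ltW d0) // ler_pdivrMr // mul1r -natrX -!natrM ler_nat.
have n2 : (0 < n ^ 2)%N by rewrite expn_gt0 n0.
have -> : (n ^ 5 = n * (n ^ 2 * n ^ 2))%N by rewrite -expnD -expnS.
have H : ((n ^ 2).+2 <= 24 * (n ^ 2 * n ^ 2))%N.
  move: (n ^ 2)%N n2 => k k0; have m0 := leq_mul k0 k0.
  rewrite -addn2; apply: leq_trans (leq_add (leq_pmulr k k0) (leq_mul (leqnn 2) m0)) _.
  by rewrite -mulSn leq_mul2r orbT.
have -> : (24 * #|S| * #|A| * (n * (n ^ 2 * n ^ 2)) =
    n * #|S| * #|A| * (24 * (n ^ 2 * n ^ 2)))%N by ring.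
by rewrite leq_mul2l H orbT.
Qed.

Lemma esp_VE X i : esp_V r delta X i = viter r (g i) (M i) (Phat X) (T i).
Proof. by []. Qed.

Lemma esp_index_bounds i : esp_index R n i ->
  [/\ (i < n)%N, 4 <= M i & M i <= 2 * n%:R].
Proof.
rewrite esp_indexE // => /andP[i2 in_]; split.
- have := leq_ltn_trans (ltn_expl i.-1 (isT : 1 < 2)%N) in_.
  by case: (i) i2 => //.
- by rewrite /esp_M (_ : 4 = 2 ^+ 2) ?ler_weXn2l ?ler1n // -natrX.
- rewrite /esp_M -(prednK (ltnW i2)) exprS ler_wpM2l //.
  by rewrite -natrX ler_nat ltnW.
Qed.

Lemma discount_pow i : g i ^+ T i <= (1 - g i) ^+ 2 / n%:R / 3.
Proof.
by apply: plan_T_pow; rewrite // invr_gt0 nR0 invf_le1 // ler1n.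
Qed.

Lemma discount_le1 i : (1 - g i) <= 1 /\ 0 < 1 - g i.
Proof. by have := g01 i; lra. Qed.

Lemma discount_pow_theta i : g i ^+ T i <= th i.
Proof.
have [g1 g1'] := discount_le1 i; have t0 := th0 i.
apply: le_trans (discount_pow i) _.
have : (1 - g i) ^+ 2 / n%:R <= th i.
  apply: le_trans (invn_le_theta S0 A0 d01 n0 i).
  rewrite -[leRHS]mul1r ler_wpM2r ?invr_ge0 ?(ltW nR0) //.
  by rewrite exprn_ile1 // ltW.
by move: (_ / n%:R) => z; lra.
Qed.

(** Rounding the q-value down to the grid costs [1 / n], and stopping the iteration at [T i] costs
    another [1 / n]. *)
Lemma pin_iter_error X i s a : (1 - g i)^-1 <= n%:R ->
  exists k : 'I_(n ^ 2).+1, forall x,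
    `|pin_iter r (g i) (M i) (s, a) (k%:R / n%:R) (Phat X) (T i) x -
      viter r (g i) (M i) (Phat X) (T i) x| <= 2 / n%:R.
Proof.
move=> Hn; have kQ : is_kernel (Phat X) by exact: is_kernel_emp.
have [g1 g1'] := discount_le1 i; have /andP[g0 _] := g01 i.
set V := viter _ _ _ _ _.
set u := qvalue r (g i) (Phat X) V s a.
have V0 x : 0 <= V x by apply: viter_ge0 => //; exact: ltW.
have u0 : 0 <= u by apply: qvalue_ge0.
have un : u <= n%:R.
  apply: le_trans Hn.
  have -> : (1 - g i)^-1 = 1 + g i * (1 - g i)^-1 by field; rewrite lt0r_neq0.
  rewrite /u /qvalue lerD //; first by case/andP: (r01 s a).
  rewrite ler_wpM2l //; apply: mean_le => [|x]; first exact: kQ.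
  by apply: viter_le.
have un0 : 0 <= u * n%:R by rewrite mulr_ge0.
have /andP[k1 k2] := truncn_itv un0.
set k := Num.truncn (u * n%:R) in k1 k2.
have kn : (k < (n ^ 2).+1)%N.
  rewrite ltnS -(ler_nat R); apply: le_trans k1 _.
  by rewrite natrX expr2 ler_wpM2r // ltW.
exists (Ordinal kn) => x /=.
have uk : `|k%:R / n%:R - u| <= n%:R^-1.
  rewrite -(mulfK (lt0r_neq0 nR0) u) -mulrBl normrM [X in _ * X]gtr0_norm ?invr_gt0 //.
  rewrite -[leRHS]mul1r ler_wpM2r ?invr_ge0 ?(ltW nR0) // ler_norml.
  by move: k2; rewrite -natr1; lra.
have gT : (g i ^+ T i + g i ^+ T i) * (1 - g i)^-1 <= n%:R^-1.
  rewrite ler_pdivrMr //.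
  have := discount_pow i; move=> gT.
  have : (1 - g i) ^+ 2 / n%:R / 3 <= n%:R^-1 * (1 - g i) / 3.
    rewrite ler_pM2r // mulrC ler_pM2l ?invr_gt0 // expr2.
    by rewrite ler_piMl // ltW.
  have : 0 <= n%:R^-1 * (1 - g i) by rewrite mulr_ge0 ?invr_ge0 ?ltW.
  move: gT; move: (n%:R^-1 * _) (_ / n%:R / 3) (g i ^+ T i) => z w y; lra.
have c1 := pin_iter_lip r (M i) (g01 i) (s, a) (k%:R / n%:R) u (T i) x kQ.
have c2 := pin_iter_close r01 (g01 i) (ltW (M0 i)) (s, a) (T i) (T i) x kQ.
apply: le_trans (ler_distD (pin_iter r (g i) (M i) (s, a) u (Phat X) (T i) x) _ _) _.
apply: le_trans (lerD (le_trans c1 uk) (le_trans c2 gT)) _.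
by rewrite -mulr2n -[leLHS]mulr_natl.
Qed.

Lemma esp_Phi_le_gain X i (pihat : S -> A) : good X -> esp_index R n i ->
  plan_policy (Phat X) r (g i) (M i) n%:R^-1 pihat ->
  forall s, esp_Phi r delta X i <= gain P r (det_policy R pihat) s.
Proof.
move=> gX /esp_index_bounds[i_n M4 M2] greedy s.
have kQ : is_kernel (Phat X) by exact: is_kernel_emp.
have [g1 g1'] := discount_le1 i; have /andP[g0 _] := g01 i.
have t0 := th0 i.
set V := viter r (g i) (M i) (Phat X) (T i).
have V0 x : 0 <= V x by apply: viter_ge0 => //; exact: ltW.
have gain0 : 0 <= gain P r (det_policy R pihat) s.
  have ppi : is_policy (det_policy R pihat) by exact: is_policy_det.
  by apply: (gain_ge0 kP ppi) => x a; case/andP: (r01 x a).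
have W96 : 96 * th i <= al * Num.sqrt ((M i + 1) / n%:R).
  apply: le_trans (theta_le S0 A0 d01 n0 i) _; apply: ler_wpM2l.
    by apply: le_trans (alpha_ge96 S0 A0 d01 n0).
  rewrite ler_wsqrtr // ler_wpM2r ?invr_ge0 ?(ltW nR0) //.
  by rewrite lerDl.
rewrite /esp_Phi esp_VE -/V.
(* Above the threshold the penalty exceeds 1, while [(1 - g) min V <= 1]; so [esp_Phi] is not
   positive. *)
have [th96|th96] := leP (th i) 96^-1; last first.
  apply: le_trans gain0; rewrite subr_le0.
  apply: (@le_trans _ _ 1); last by lra.
  rewrite -[leRHS](mulfV (lt0r_neq0 g1')) ler_pM2l //.
  by apply: le_trans (fmin_le V s) _; apply: viter_le.
have th_n := invn_le_theta S0 A0 d01 n0 i.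
have low : (1 - g i) * fmin V - 25 * th i <= gain P r (det_policy R pihat) s.
  apply: (gain_lower kP r01 (g01 i) (ltW t0) th96 (ltW (l0 i)) (lM i) kQ V0).
  - by move=> x y; apply: viter_span; exact: ltW.
  - move=> x.
    have /ler_normlP[res _] := viter_residual r01 (g01 i) (ltW (M0 i)) (T i) x kQ.
    have {}res := le_trans res (discount_pow_theta i).
    have step : vstep r (g i) (M i) (Phat X) V x <=
        r x (pihat x) + g i * mean (Phat X x (pihat x)) V.
      apply: le_trans (clip_le _ _ _) _; rewrite /bellman.
      apply: fmax_le => [|a]; last exact: greedy.
      exact: (qvalue_ge0 r01 (g01 i) x (pihat x) kQ V0).
    by move: res; rewrite -/V; lra.
  (* The grid point depends on the samples, which is harmless because [good] holds for all grid
     points at once. *)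
  - move=> x; have [k ek] := pin_iter_error X x (pihat x) (esp_horizon_le S0 A0 d01 n0 M2).
    apply: (concentration_transfer (ltW t0) th96 (ltW (l0 i)) (lM i) _ _ M4 _ ek).
    + exact: kP.
    + exact: kQ.
    + by rewrite ler_wpM2l.
    + exact: (gX (Ordinal i_n) x (pihat x) (Some k) th96).
by lra.
Qed.

(** The factor 9 collects [6 W] for discounting, at most [W] for the multiples of [theta], and [2 W]
    for the penalty. *)
Lemma le_esp_Phi X i rho pi : good X -> esp_index R n i -> th i <= 96^-1 ->
  feasible i rho pi (anchor i) ->
  rho - 9 * (al * Num.sqrt (M i / n%:R)) <= esp_Phi r delta X i.
Proof.
move=> gX /esp_index_bounds[i_n M4 M2] th96 [ppi rho01 hM hsub].
have kQ : is_kernel (Phat X) by exact: is_kernel_emp.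
have [g1 g1'] := discount_le1 i; have t0 := th0 i.
have [s0 _] : exists s : S, s \in S by apply/card_gt0P.
have al0 : 0 <= al by apply: le_trans (alpha_ge96 S0 A0 d01 n0).
set W := al * Num.sqrt (M i / n%:R).
have W96 : 96 * th i <= W := theta_le S0 A0 d01 n0 i.
have gM : (1 - g i) * M i <= 3 * W := esp_gamma_span S0 A0 d01 n0 i.
have gM0 : 0 <= (1 - g i) * M i by rewrite mulr_ge0 // ltW.
have Mn0 : 0 <= M i / n%:R by rewrite divr_ge0 // ltW.
have sq2 : al * Num.sqrt ((M i + 1) / n%:R) <= 2 * W.
  rewrite mulrCA ler_wpM2l // -[2]ger0_norm // -sqrtr_sqr -sqrtrM ?sqr_ge0 //.
  rewrite ler_wsqrtr // mulrA ler_wpM2r ?invr_ge0 ?(ltW nR0) //.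
  by rewrite expr2; lra.
have low x : rho - 9 * th i - (1 - g i) * M i - g i ^+ T i * (1 + (1 - g i) * M i)
    <= (1 - g i) * viter r (g i) (M i) (Phat X) (T i) x.
  apply: (value_lower kP r01 (g01 i) (ltW t0) th96 (ltW (l0 i)) (lM i) _ _ kQ ppi rho01 hM hsub).
  move=> y a; have := gX (Ordinal i_n) y a None th96.
  rewrite /concentrates /test_fun !meanN /=.
  have -> : mean (P y a) (fun x => (- corrected i x - - corrected i y) ^+ 2) =
      mean (P y a) (fun x => (corrected i x - corrected i y) ^+ 2).
    by apply: eq_mean => z; ring.
  by rewrite /corrected; lra.
have gT : g i ^+ T i * (1 + (1 - g i) * M i) <= th i + (1 - g i) * M i.
  have gTth := discount_pow_theta i.
  by rewrite mulrDr mulr1 lerD // ler_piMl // (le_trans gTth) //; clear gTth; lra.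
have : rho - 7 * W <= (1 - g i) * fmin (esp_V r delta X i).
  rewrite esp_VE [leRHS]mulrC -ler_pdivrMr //; apply: (le_fmin s0) => x.
  rewrite ler_pdivrMr // [leRHS]mulrC; apply: le_trans (low x).
  by move: gT; move: (_ * (1 + _)) => z; move: gM gM0; move: (_ * M i) => w; lra.
by clear gT; rewrite /esp_Phi; move: (_ * fmin _) => z; lra.
Qed.

(** Take the least exponent that works: either it is 2, or the preceding scale is below [2 H]. *)
Lemma scale_exists (H : R) : 0 <= H ->
  exists i, [/\ (2 <= i)%N, 2 * H <= M i & M i <= 4 * (H + 1)].
Proof.
move=> H0; pose p i := (2 <= i)%N && (2 * H <= M i).
have ex : exists i, p i.
  exists (maxn 2 (Num.bound (2 * H))); rewrite /p leq_maxl /=.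
  have H2 : 0 <= 2 * H by lra.
  apply: le_trans (ltW (archi_boundP H2)) _.
  rewrite /esp_M -natrX ler_nat; apply: leq_trans (leq_maxr 2 _) _.
  exact: ltnW (ltn_expl _ _).
case: (ex_minnP ex) => i /andP[i2 HM] imin; exists i; split=> //.
case: (ltnP 2 i) => [i3|i3]; last first.
  have -> : i = 2 by apply/eqP; rewrite eqn_leq i3.
  by rewrite /esp_M expr2; lra.
have ip : (i.-1 < i)%N by rewrite prednK // ltnW // ltnW.
have : ~~ p i.-1 by apply/negP => /imin; rewrite leqNgt ip.
rewrite /p -ltnS prednK ?i3 ?(ltnW (ltnW i3)) //= -ltNge => MH.
rewrite /esp_M -(prednK (ltnW (ltnW i3))) exprS; move: MH; rewrite /esp_M.
by move: (2 ^+ _) => z; lra.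
Qed.

(** Compares with the scale matching the span [H] of the bias, where [W <= 2 Z]. The loss [9 W]
    becomes [18 Z]; the constant 20 also covers the [1 / n] lost to the anchor. *)
Lemma esp_regret X ihat pi : good X -> is_policy pi ->
  (forall s s', gain P r pi s = gain P r pi s') ->
  (forall j, esp_index R n j -> esp_Phi r delta X j <= esp_Phi r delta X ihat) ->
  forall s, gain P r pi s
    - 20 * al * Num.sqrt ((spnorm (bias P r pi) + 1) / n%:R)
    <= Num.max (esp_Phi r delta X ihat) 0.
Proof.
move=> gX ppi cst best s.
set b := bias P r pi; set H := spnorm b.
have H0 : 0 <= H by exact: spnorm_ge0.
have [i [i2 HM MH]] := scale_exists H0.
have al96 := alpha_ge96 S0 A0 d01 n0.
have al0 : 0 <= al by apply: le_trans al96.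
set Z := al * Num.sqrt ((H + 1) / n%:R).
set W := al * Num.sqrt (M i / n%:R).
have WZ : W <= 2 * Z.
  rewrite [leRHS]mulrCA ler_wpM2l // -[2]ger0_norm // -sqrtr_sqr -sqrtrM ?sqr_ge0 //.
  rewrite ler_wsqrtr // mulrA ler_wpM2r ?invr_ge0 ?(ltW nR0) //.
  by rewrite expr2; lra.
have W96 : 96 * th i <= W := theta_le S0 A0 d01 n0 i.
rewrite -mulrA -/Z.
have gain1 x : 0 <= gain P r pi x <= 1.
  apply/andP; split.
    by apply: (gain_ge0 kP ppi) => y a; case/andP: (r01 y a).
  apply: gain_le => // y; apply: (mean_le (ppi y)) => a.
  by case/andP: (r01 y a).
have /andP[gs0 gs1] := gain1 s.
(* Gains are at most 1, so once [W >= 1] the truncation at 0 suffices. This settles scales outside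
   the searched range and those with large [theta]. *)
have trivial_case : 1 <= W ->
    gain P r pi s - 20 * Z <= Num.max (esp_Phi r delta X ihat) 0.
  by move=> W1; rewrite le_max; apply/orP; right; lra.
case: (boolP (esp_index R n i)) => [idx|]; last first.
  rewrite esp_indexE // i2 /= -leqNgt => nM; apply: trivial_case.
  rewrite -[leLHS]mulr1; apply: ler_pM => //; first by lra.
  rewrite -[leLHS]sqrtr1 ler_wsqrtr // ler_pdivlMr // mul1r.
  apply: (@le_trans _ _ (2 ^+ i.-1)); first by rewrite -natrX ler_nat.
  by rewrite /esp_M ler_weXn2l ?ler1n // leq_pred.
have [th96|th96] := leP (th i) 96^-1; last by apply: trivial_case; lra.
(* Shifting the bias preserves the Poisson equation and puts its values in [[0, H]], within
   [[0, M i / 2]]. *)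
pose h x := b x - fmin b.
have feas : feasible i (gain P r pi s) pi h.
  split=> // x; first rewrite subr_ge0 fmin_le /=.
    apply: (@le_trans _ _ H); first by rewrite /H /spnorm lerD2r le_fmax.
    by lra.
  have := poisson_equation r kP ppi x; rewrite -/b (cst s x) => peq.
  rewrite /h [kop _ _ x]meanD mean_cst; last exact: is_dist_Ppi kP ppi x.
  by rewrite addrA peq addrA.
have [rho0 [pi0 [feas0 le0]]] := anchor_near_optimal feas.
have := le_esp_Phi gX idx th96 feas0; have := best i idx.
have := invn_le_theta S0 A0 d01 n0 i; have t0 := th0 i.
rewrite -/W le_max => nth bi Pi; apply/orP; left; lra.
Qed.

End Algorithm.

Theorem theorem4 (R : realType) :
  exists C4 : R,
  forall (S A : finType) (P : S -> A -> S -> R) (r : S -> A -> R)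
         (delta : R) (n : nat),
    is_kernel P ->
    weakly_communicating P ->
    (forall s a, 0 <= r s a <= 1) ->
    0 < delta < 1 ->
    (1 <= n)%N ->
    sample_prob P
      (fun X : {ffun S * A * 'I_n -> S} =>
         forall (pihat : S -> A) (rhohat : R),
           esp_output r delta X pihat rhohat ->
           (forall s, rhohat <= gain P r (det_policy R pihat) s) /\
           (forall pi : S -> A -> R, is_policy pi ->
              (forall s s', gain P r pi s = gain P r pi s') ->
              forall s, gain P r pi s
                        - C4 * alpha S A delta n
                            * Num.sqrt ((spnorm (bias P r pi) + 1) / n%:R)
                        <= rhohat))
    >= 1 - delta.
Proof.
exists 20 => S A P r delta n kP _ r01 d01 n0.
(* If [S] or [A] is empty, the event holds for every sample: there is no state to check, or no
   [pihat]. *)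
have [S0|S0] := posnP #|S|.
  apply: (@le_trans _ _ 1); first by case/andP: d01; lra.
  rewrite -(sample_prob_total n kP); apply: le_sample_prob => // X _.
  by move=> pihat rhohat _; split=> [s|pi _ _ s]; have := fintype0 s; rewrite S0.
have [A0|A0] := posnP #|A|.
  apply: (@le_trans _ _ 1); first by case/andP: d01; lra.
  rewrite -(sample_prob_total n kP); apply: le_sample_prob => // X _.
  move=> pihat; case/card_gt0P: S0 => s _.
  by have := fintype0 (pihat s); rewrite A0.
apply: le_trans (good_prob r kP S0 A0 d01 n0) _.
apply: le_sample_prob => // X gX pihat _ [ihat [idx best greedy ->]].
split=> [s|pi ppi cst s].
  rewrite ge_max (esp_Phi_le_gain kP r01 S0 A0 d01 gX idx greedy) /=.
  have ppi : is_policy (det_policy R pihat) by exact: is_policy_det.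
  by apply: (gain_ge0 kP ppi) => x a; case/andP: (r01 x a).
exact: (esp_regret kP r01 S0 A0 d01 gX ppi cst best).
Qed.
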